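(* Let $\nu$ range over real numbers with $\nu>-2$, $\nu\neq-1$, and let $\varphi_{\nu}(z)=2^{\nu}\Gamma(\nu+1)z^{-\frac{\nu}{2}}J_{\nu}(\sqrt{z})$. Let $\nu^{\star}\simeq-1.7744\dots$ be the root in $(-2,\infty)$ of the equation $J_{\nu+1}(1)=0$ (in the unknown $\nu$). For each $\alpha\in[0,1)$ the equation $$(2\nu+2\alpha)J_{\nu+1}(1)= J_{\nu}(1)$$ has a unique root $\nu_\alpha$ in $(\nu^{\star},\infty)$, and $\varphi_{\nu}$ is convex of order $\alpha$ in the open unit disk $\mathbb{D}$ if and only if $\nu\geq\nu_{\alpha}$. In particular, $\varphi_{\nu}$ is convex in $\mathbb{D}$ if and only if $\nu\geq \nu_0$, where $\nu_0\simeq-1.5623\dots$ is the unique root of the equation $J_{\nu}(1)=2\nu J_{\nu+1}(1)$ situated in $(\nu^{\star},\infty)$.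
   Context: $J_\nu$ is the Bessel function of the first kind, $J_{\nu}(z)=\sum_{n\geq0}\frac{(-1)^{n}}{n!\,\Gamma(n+\nu+1)}\left(\frac{z}{2}\right)^{2n+\nu}$ (with $1/\Gamma=0$ at the poles of $\Gamma$). The function $\varphi_\nu$ is entire: $\varphi_{\nu}(z)=\sum_{n\ge 0}\frac{(-1)^n\Gamma(\nu+1)}{4^n n!\,\Gamma(n+\nu+1)}z^{n}=1-\frac{1}{4(\nu+1)}z+\dots$. $\mathbb{D}=\{z\in\mathbb{C}:|z|<1\}$. A (not necessarily normalized) function $f:\mathbb{D}\to\mathbb{C}$ with $f'(0)\neq0$ is convex of order $\alpha\in[0,1)$ in $\mathbb{D}$ if it is analytic and univalent in $\mathbb{D}$ and $\operatorname{Re}\left(1+\frac{zf''(z)}{f'(z)}\right)>\alpha$ for all $z\in\mathbb{D}$; convex means convex of order $0$.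
   Formalization: The printed value ν* ≃ -1.7744… has a wrong last digit (the root of J_{ν+1}(1)=0 in (-2,∞) is about -1.77456), so the formal theorem asserts only -1.775 < ν* < -1.774. *)

(* Defs.v *)
From Stdlib Require Import Reals Lra Factorial.
From Coquelicot Require Import Coquelicot.
Open Scope R_scope.

(* Reciprocal Gamma function on the whole real line, by the Euler-Gauss limit
     Gamma(x) = lim_n n! n^x / (x (x+1) ... (x+n)).
   It vanishes at 0, -1, -2, ..., i.e. 1/Gamma = 0 at the poles of Gamma.
   The quotient at n = 0 is irrelevant to the limit. *)
Definition rGamma (x : R) : R :=
  real (Lim_seq (fun n => prod_f_R0 (fun k => x + INR k) n
                          / (INR (fact n) * Rpower (INR n) x))).

(* Meaningful away from the poles 0, -1, -2, ... *)
Definition Gamma (x : R) : R := / rGamma x.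

(* J_nu(x) for real order and real x > 0 ([Rpower] is the real power of a
   positive base). *)
Definition BesselJ (nu x : R) : R :=
  Series (fun n => (-1) ^ n / INR (fact n) * rGamma (INR n + nu + 1)
                   * Rpower (x / 2) (2 * INR n + nu)).

(* Sum of a convergent complex series: its real and imaginary parts are the
   sums of the real and imaginary parts. *)
Definition CSeries (a : nat -> C) : C :=
  (Series (fun n => Re (a n)), Series (fun n => Im (a n))).

Definition phi_coef (nu : R) (n : nat) : R :=
  (-1) ^ n * Gamma (nu + 1) / (4 ^ n * INR (fact n))
  * rGamma (INR n + nu + 1).

(* The entire function 2^nu Gamma(nu+1) z^(-nu/2) J_nu(sqrt z), given by its
   Taylor series so that no branch of the powers has to be chosen; see
   [phi_BesselJ]. *)
Definition phi (nu : R) (z : C) : C :=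
  CSeries (fun n => (RtoC (phi_coef nu n) * Cpow z n)%C).

(* Analytic means complex differentiable at every point of the disk.  As
   division is total, [C_derive f z <> 0] is needed for the quotient f''/f' to
   make sense; at z = 0 it is the standing assumption f'(0) <> 0.  [C_derive]
   takes the limit along the real direction, which is the complex derivative
   wherever the latter exists ([C_derive_correct]). *)
Definition convex_of_order (alpha : R) (f : C -> C) : Prop :=
  (forall z : C, Cmod z < 1 ->
     ex_derive (K := C_AbsRing) (V := C_NormedModule) f z) /\
  (forall z w : C, Cmod z < 1 -> Cmod w < 1 -> f z = f w -> z = w) /\
  (forall z : C, Cmod z < 1 ->
     C_derive f z <> RtoC 0 /\
     Re (RtoC 1 + z * C_derive (C_derive f) z / C_derive f z)%C > alpha).

Definition convex (f : C -> C) : Prop := convex_of_order 0 f.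

Lemma Cpow_RtoC (x : R) (n : nat) : Cpow (RtoC x) n = RtoC (x ^ n).
Proof.
  induction n as [|n IH]; [reflexivity|].
  simpl; rewrite IH, <- RtoC_mult; reflexivity.
Qed.

Lemma phi_BesselJ (nu x : R) : 0 < x ->
  phi nu (RtoC x) =
  RtoC (Rpower 2 nu * Gamma (nu + 1) * Rpower x (- nu / 2)
        * BesselJ nu (sqrt x)).
Proof.
  intros Hx.
  apply injective_projections; cbn [phi CSeries RtoC fst snd].
  - unfold BesselJ; rewrite <- Series_scal_l; apply Series_ext; intro n.
    rewrite Cpow_RtoC, <- RtoC_mult; simpl Re.
    unfold phi_coef.
    assert (H2n : Rpower (sqrt x / 2) (2 * INR n) = x ^ n / 4 ^ n).
    { replace (2 * INR n) with (INR (2 * n)) by (rewrite mult_INR; simpl; ring).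
      assert (Hs : 0 < sqrt x) by now apply sqrt_lt_R0.
      rewrite Rpower_pow by lra.
      rewrite pow_mult.
      replace ((sqrt x / 2) ^ 2) with (x * / 4).
      - rewrite Rpow_mult_distr, pow_inv; reflexivity.
      - rewrite <- (sqrt_sqrt x) at 1 by lra; field. }
    assert (Hnu : Rpower (sqrt x / 2) nu * Rpower 2 nu * Rpower x (- nu / 2) = 1).
    { assert (Hs : 0 < sqrt x) by now apply sqrt_lt_R0.
      rewrite Rpower_mult_distr by lra.
      replace (sqrt x / 2 * 2) with (sqrt x) by field.
      rewrite <- Rpower_sqrt by assumption.
      rewrite Rpower_mult, <- Rpower_plus.
      replace (/ 2 * nu + - nu / 2) with 0 by field.
      now apply Rpower_O. }
    rewrite Rpower_plus, H2n.
    transitivity ((-1) ^ n * Gamma (nu + 1) / (4 ^ n * INR (fact n))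
      * rGamma (INR n + nu + 1) * x ^ n
      * (Rpower (sqrt x / 2) nu * Rpower 2 nu * Rpower x (- nu / 2))).
    + rewrite Hnu; ring.
    + field; split; [apply pow_nonzero; lra | apply INR_fact_neq_0].
  - rewrite (Series_ext _ (fun _ => 0 * 0)).
    + rewrite Series_scal_l; ring.
    + intro n; rewrite Cpow_RtoC, <- RtoC_mult; simpl; ring.
Qed.

(* Main.v *)
Require Import Defs.
From Stdlib Require Import Reals Arith Factorial Lra Lia FunctionalExtensionality Ranalysis5.
From Coquelicot Require Import Coquelicot.
Open Scope R_scope.

(* Put m = nu + 2 > 0.  Then phi_nu' is a constant multiple of psi = phi_(nu+1),
   so the quantity to control is 1 + z psi'(z) / psi(z) = 1 - h(z).  The function
   h = - z psi' / psi solves the Riccati equation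
   z h' + (m - 1) h = h^2 + z / 4, which gives a convolution recurrence for its
   Taylor coefficients: they are nonnegative, decrease with m, and the n-th one
   is at most (4 m)^(-n).  Hence, for m > 1/4, |h(z)| < h(1) in the unit disk,
   and convexity of order alpha amounts to h(1) <= 1 - alpha, a condition
   monotone in m whose boundary case is the stated equation between J_nu(1) and
   J_(nu+1)(1).  Univalence follows from |psi - 1| < 1.  For m <= 1/4 convexity
   already fails at the real point z = 16 m / 5. *)

(** The coefficients of h are classically power sums of reciprocal zeros of psi. Here they are
    defined by the recurrence, so signs and monotonicity are read off the recurrence; only
    afterwards is h psi = - z psi' proved, by showing that the defect satisfies a homogeneous
    recurrence.

    The bound (4 m)^(-n) is summable at z = 1 exactly for m > 1/4, whereas nustar + 2 is about
    0.2256, slightly below 1/4. The window between the two has to be treated apart: there m psi(1)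
    is too small compared with - m psi'(1) for the boundary equation to hold, and the order
    condition is refuted at a real point. Univalence and nonvanishing use m > 1/3, which the
    threshold satisfies, since it is at least 0.4376 for every alpha.

    Estimates are made on m psi instead of psi: its coefficient of z is - 1/4 whatever m is, and
    from there on the terms shrink by at least a factor 4 at z = 1. Hence geometric tails are
    uniform in m > 0, and a few terms decide every sign that is needed. Uniqueness of the root comes
    from the strict decrease of h(1) in m. *)

(** * Geometric majorants for real series *)

Lemma ex_series_le_R (a b : nat -> R) :
  (forall n, Rabs (a n) <= b n) -> ex_series b -> ex_series a.
Proof. exact (@ex_series_le R_AbsRing R_CompleteNormedModule a b). Qed.

Lemma ex_series_scal_R (c : R) (a : nat -> R) :
  ex_series a -> ex_series (fun n => c * a n).
Proof. exact (@ex_series_scal_l R_AbsRing R_NormedModule c a). Qed.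

Lemma ex_series_ext_R (a b : nat -> R) :
  (forall n, a n = b n) -> ex_series a -> ex_series b.
Proof. exact (@ex_series_ext R_AbsRing R_NormedModule a b). Qed.

Lemma Series_tail_le (a : nat -> R) (N : nat) (M q : R) :
  0 <= q < 1 ->
  (forall k, Rabs (a (S N + k)%nat) <= M * q ^ k) ->
  ex_series (fun n => Rabs (a n)) /\
  Rabs (Series a - sum_f_R0 a N) <= M / (1 - q).
Proof.
  intros Hq Ha.
  assert (Hgeom : is_series (fun k => M * q ^ k) (M / (1 - q))).
  { apply (is_series_scal_l M _ (/ (1 - q))), is_series_geom.
    rewrite Rabs_pos_eq; lra. }
  assert (Htail : ex_series (fun k => Rabs (a (S N + k)%nat))).
  { apply ex_series_le_R with (b := fun k => M * q ^ k).
    - intro k; rewrite Rabs_Rabsolu; apply Ha.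
    - eexists; apply Hgeom. }
  assert (Habs : ex_series (fun n => Rabs (a n))).
  { apply (ex_series_incr_n (fun n => Rabs (a n)) (S N)); exact Htail. }
  split; [exact Habs|].
  rewrite (Series_incr_n a (S N)) by (lia || now apply ex_series_Rabs).
  simpl pred.
  match goal with |- Rabs (?s + ?t - ?s) <= _ =>
    replace (s + t - s) with t by ring end.
  eapply Rle_trans; [apply Series_Rabs, Htail|].
  rewrite <- (is_series_unique _ _ Hgeom).
  apply Series_le; [|eexists; apply Hgeom].
  intro k; split; [apply Rabs_pos | apply Ha].
Qed.

Lemma Series_ratio_tail_le (a : nat -> R) (N : nat) (q : R) :
  0 <= q < 1 ->
  (forall n, (N <= n)%nat -> Rabs (a (S n)) <= q * Rabs (a n)) ->
  ex_series (fun n => Rabs (a n)) /\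
  Rabs (Series a - sum_f_R0 a N) <= Rabs (a N) * q / (1 - q).
Proof.
  intros Hq Ha.
  apply Series_tail_le; [exact Hq|].
  induction k as [|k IH].
  - rewrite Nat.add_0_r, pow_O, Rmult_1_r, Rmult_comm; apply Ha; lia.
  - rewrite Nat.add_succ_r.
    eapply Rle_trans; [apply Ha; lia|].
    simpl pow.
    apply Rle_trans with (q * (Rabs (a N) * q * q ^ k)).
    + apply Rmult_le_compat_l; [lra | exact IH].
    + right; ring.
Qed.

(** * The series of m psi at z = 1 and their dependence on m *)

(* Taylor coefficients of [phi (m - 1)]. *)
Fixpoint psi_coef (m : R) (n : nat) : R :=
  match n with
  | O => 1
  | S k => - psi_coef m k / (4 * INR (S k) * (m + INR k))
  end.

(* The factor [m] removes the pole of [psi_coef] at [m = 0]: with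
   [psi = phi (m - 1)], [T m = m * psi 1] and [U m = - m * psi' 1]. *)
Definition tau (m : R) (n : nat) : R := m * psi_coef m n.

Definition T (m : R) : R := Series (tau m).

Definition U (m : R) : R := - Series (fun n => INR n * tau m n).

Lemma tau_S (m : R) (n : nat) :
  tau m (S n) = - tau m n / (4 * INR (S n) * (m + INR n)).
Proof. unfold tau; cbn [psi_coef]; unfold Rdiv; ring. Qed.

Lemma tau_0 (m : R) : tau m 0 = m.
Proof. unfold tau; simpl; ring. Qed.

Lemma tau_1 (m : R) : 0 < m -> tau m 1 = - / 4.
Proof. intro Hm; rewrite tau_S, tau_0; simpl; field; lra. Qed.

Lemma INR_S_ge_1 (n : nat) : 1 <= INR (S n).
Proof. rewrite S_INR; pose proof (pos_INR n); lra. Qed.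

Lemma Rabs_div_pos (x y : R) : 0 < y -> Rabs (x / y) = Rabs x / y.
Proof.
  intro Hy; unfold Rdiv; rewrite Rabs_mult, (Rabs_pos_eq (/ y)); [reflexivity|].
  left; now apply Rinv_0_lt_compat.
Qed.

Lemma Rdiv_le_l (x y z : R) : 0 < y -> x <= z * y -> x / y <= z.
Proof.
  intros Hy H; apply Rmult_le_reg_r with y; [exact Hy|].
  unfold Rdiv; rewrite Rmult_assoc, Rinv_l; lra.
Qed.

(** The weight [INR (S n)] cancels the one in the recurrence and leaves 1 / (4 (m + n)). Keeping it
    on the left is what lets the series weighted by n contract by 1/4 as well. *)
Lemma tau_ratio (m : R) (n : nat) : 0 < m -> (1 <= n)%nat ->
  INR (S n) * Rabs (tau m (S n)) <= / 4 * Rabs (tau m n).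
Proof.
  intros Hm Hn; rewrite tau_S.
  apply le_INR in Hn; simpl in Hn; pose proof (INR_S_ge_1 n).
  assert (Hd : 0 < 4 * INR (S n) * (m + INR n)) by nra.
  rewrite Rabs_div_pos, Rabs_Ropp by exact Hd.
  pose proof (Rabs_pos (tau m n)).
  replace (INR (S n) * (Rabs (tau m n) / (4 * INR (S n) * (m + INR n))))
    with (Rabs (tau m n) / (4 * (m + INR n))) by (field; split; lra).
  apply Rdiv_le_l; [lra|]; nra.
Qed.

Lemma tau_ratio_scaled (m b : R) (n : nat) : 0 < m -> 0 <= b -> (1 <= n)%nat ->
  Rabs ((b + INR (S n)) * tau m (S n)) <= / 4 * Rabs ((b + INR n) * tau m n).
Proof.
  intros Hm Hb Hn.
  pose proof (tau_ratio m n Hm Hn) as H.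
  pose proof (INR_S_ge_1 n); apply le_INR in Hn; simpl in Hn.
  rewrite !Rabs_mult, !(Rabs_pos_eq (b + _)) by (try (pose proof (pos_INR n)); lra).
  pose proof (Rabs_pos (tau m n)); pose proof (Rabs_pos (tau m (S n))).
  assert (b * Rabs (tau m (S n)) <= b * (/ 4 * Rabs (tau m n))).
  { apply Rmult_le_compat_l; [lra|]; nra. }
  nra.
Qed.

(** This is m (b psi(1) + psi'(1)). With b = 1 - alpha its vanishing is the boundary case h(1) = 1 -
    alpha multiplied by m psi(1), a form that stays meaningful where psi(1) = 0. *)
Definition W (b m : R) : R := Series (fun n => (b + INR n) * tau m n).

Lemma ex_series_W (b m : R) : 0 < m -> 0 <= b ->
  ex_series (fun n => Rabs ((b + INR n) * tau m n)).
Proof.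
  intros Hm Hb.
  apply (Series_ratio_tail_le _ 1 (/ 4)); [lra|].
  intros n Hn; now apply tau_ratio_scaled.
Qed.

Lemma W_tail (b m : R) (N : nat) : 0 < m -> 0 <= b -> (1 <= N)%nat ->
  Rabs (W b m - sum_f_R0 (fun n => (b + INR n) * tau m n) N)
    <= Rabs ((b + INR N) * tau m N) / 3.
Proof.
  intros Hm Hb HN.
  replace (Rabs ((b + INR N) * tau m N) / 3)
    with (Rabs ((b + INR N) * tau m N) * / 4 / (1 - / 4)) by field.
  apply (Series_ratio_tail_le (fun n => (b + INR n) * tau m n)); [lra|].
  intros n Hn; apply tau_ratio_scaled; [assumption..|lia].
Qed.

Lemma tau_ratio_1 (m : R) (n : nat) : 0 < m -> (1 <= n)%nat ->
  Rabs (tau m (S n)) <= / 4 * Rabs (tau m n).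
Proof.
  intros Hm Hn; pose proof (tau_ratio m n Hm Hn).
  pose proof (INR_S_ge_1 n); pose proof (Rabs_pos (tau m (S n))); nra.
Qed.

Lemma ex_series_tau (m : R) : 0 < m -> ex_series (fun n => Rabs (tau m n)).
Proof.
  intros Hm; apply (Series_ratio_tail_le _ 1 (/ 4)); [lra|].
  intros n Hn; now apply tau_ratio_1.
Qed.

Lemma T_tail (m : R) (N : nat) : 0 < m -> (1 <= N)%nat ->
  Rabs (T m - sum_f_R0 (tau m) N) <= Rabs (tau m N) / 3.
Proof.
  intros Hm HN.
  replace (Rabs (tau m N) / 3)
    with (Rabs (tau m N) * / 4 / (1 - / 4)) by field.
  apply (Series_ratio_tail_le (tau m)); [lra|].
  intros n Hn; apply tau_ratio_1; [assumption|lia].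
Qed.

Lemma ex_series_U (m : R) : 0 < m ->
  ex_series (fun n => Rabs (INR n * tau m n)).
Proof.
  intro Hm; generalize (ex_series_W 0 m Hm (Rle_refl 0)).
  apply ex_series_ext_R; intro n; now rewrite Rplus_0_l.
Qed.

Lemma W_T_U (b m : R) : 0 < m -> W b m = b * T m - U m.
Proof.
  intro Hm; unfold W, T, U.
  rewrite (Series_ext _ (fun n => b * tau m n + INR n * tau m n))
    by (intro; ring).
  rewrite Series_plus, Series_scal_l; [ring| |].
  - apply ex_series_scal_R, ex_series_Rabs, ex_series_tau, Hm.
  - apply ex_series_Rabs, ex_series_U, Hm.
Qed.

(** The leading term is 1/4 and the tail is at most a third of it, that is 1/12. *)
Lemma U_bounds (m : R) : 0 < m -> / 6 <= U m <= / 3.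
Proof.
  intro Hm; generalize (W_tail 0 m 1 Hm (Rle_refl 0) (le_n 1)).
  rewrite W_T_U by exact Hm; simpl sum_f_R0.
  rewrite tau_1 by exact Hm; simpl INR.
  rewrite (Rabs_left (_ * _)) by lra.
  intro H; apply Rabs_le_between in H; lra.
Qed.

Lemma T_bounds (m : R) : 0 < m -> m - / 3 <= T m <= m - / 6.
Proof.
  intro Hm; generalize (T_tail m 1 Hm (le_n 1)).
  simpl sum_f_R0; rewrite tau_0, tau_1 by exact Hm.
  rewrite (Rabs_left (- _)) by lra.
  intro H; apply Rabs_le_between in H; lra.
Qed.

Lemma tau_le (m : R) (n : nat) : 0 < m -> Rabs (tau m (S n)) <= / 4 ^ S n.
Proof.
  intro Hm; induction n as [|n IH].
  - rewrite tau_1, Rabs_left, pow_1; lra.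
  - eapply Rle_trans; [apply tau_ratio_1; [exact Hm|lia]|].
    simpl pow in *; rewrite Rinv_mult; lra.
Qed.

(** One step of the recurrence splits the new difference into the old difference over m' + k and the
    effect of changing the divisor. With the weight n carried along, each part is at most 1/k^2 of
    the target for k >= 2, so the sum fits. *)
Lemma tau_diff_scaled_le (m m' : R) (n : nat) : 0 < m -> 0 < m' -> (1 <= n)%nat ->
  INR n * Rabs (tau m' n - tau m n) <= Rabs (m' - m) * / 4 ^ n.
Proof.
  intros Hm Hm' Hn.
  destruct n as [|n]; [lia|]; clear Hn.
  induction n as [|n IH].
  - rewrite !tau_1, Rminus_diag, Rabs_R0, Rmult_0_r by assumption.
    apply Rmult_le_pos; [apply Rabs_pos|].
    left; apply Rinv_0_lt_compat, pow_lt; lra.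
  - set (k := S n) in *.
    assert (Hk : 1 <= INR k) by apply INR_S_ge_1.
    pose proof (INR_S_ge_1 k) as HSk.
    assert (E : INR (S k) * (tau m' (S k) - tau m (S k)) =
      / 4 * (- (tau m' k - tau m k) / (m' + INR k)
             + tau m k * (m' - m) / ((m' + INR k) * (m + INR k)))).
    { rewrite !tau_S; field; lra. }
    rewrite <- (Rabs_pos_eq (INR (S k))), <- Rabs_mult, E by lra.
    rewrite Rabs_mult, (Rabs_pos_eq (/ 4)) by lra.
    replace (Rabs (m' - m) * / 4 ^ S k) with (/ 4 * (Rabs (m' - m) * / 4 ^ k))
      by (change (4 ^ S k) with (4 * 4 ^ k); rewrite Rinv_mult; ring).
    apply Rmult_le_compat_l; [lra|].
    eapply Rle_trans; [apply Rabs_triang|].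
    rewrite !Rabs_div_pos, Rabs_Ropp, Rabs_mult by nra.
    pose proof (tau_le m n Hm) as Ht; fold k in Ht.
    set (D := Rabs (tau m' k - tau m k)) in *.
    set (d := Rabs (m' - m)) in *.
    assert (0 <= D) by apply Rabs_pos; assert (0 <= d) by apply Rabs_pos.
    assert (0 < / 4 ^ k) by (apply Rinv_0_lt_compat, pow_lt; lra).
    assert (B2 : Rabs (tau m k) * d / ((m' + INR k) * (m + INR k))
                 <= d * / 4 ^ k * / (INR k * INR k)).
    { apply Rmult_le_compat.
      - apply Rmult_le_pos; [apply Rabs_pos|lra].
      - left; apply Rinv_0_lt_compat; nra.
      - rewrite Rmult_comm; apply Rmult_le_compat_l; lra.
      - apply Rinv_le_contravar; nra. }
    (* For k = 1 the estimate 2 / k^2 is too large, but the old difference vanishes because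
       [tau m 1] does not depend on m. *)
    destruct n as [|n].
    { assert (HD : D = 0).
      { unfold D, k; rewrite !tau_1, Rminus_diag, Rabs_R0 by assumption; reflexivity. }
      rewrite HD; unfold Rdiv at 1; rewrite Rmult_0_l, Rplus_0_l.
      eapply Rle_trans; [apply B2|].
      unfold k; simpl; right; field. }
    assert (Hk2 : 2 <= INR k)
      by (unfold k; rewrite !S_INR; pose proof (pos_INR n); lra).
    assert (B1 : D / (m' + INR k) <= d * / 4 ^ k * / (INR k * INR k)).
    { apply Rdiv_le_l; [lra|].
      apply Rmult_le_reg_l with (INR k); [lra|].
      eapply Rle_trans; [apply IH|].
      replace (INR k * (d * / 4 ^ k * / (INR k * INR k) * (m' + INR k)))
        with (d * / 4 ^ k * ((m' + INR k) / INR k)) by (field; split; [lra|apply pow_nonzero; lra]).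
      rewrite <- (Rmult_1_r (d * / 4 ^ k)) at 1.
      apply Rmult_le_compat_l; [nra|].
      apply Rmult_le_reg_r with (INR k); [lra|].
      unfold Rdiv; rewrite Rmult_assoc, Rinv_l; lra. }
    assert (Hq : / (INR k * INR k) <= / 4) by (apply Rinv_le_contravar; nra).
    assert (0 <= d * / 4 ^ k) by nra.
    assert (d * / 4 ^ k * / (INR k * INR k) <= d * / 4 ^ k * / 4)
      by (apply Rmult_le_compat_l; lra).
    lra.
Qed.

Lemma tau_diff_le (m m' : R) (n : nat) : 0 < m -> 0 < m' ->
  Rabs (tau m' n - tau m n) <= Rabs (m' - m) * / 4 ^ n.
Proof.
  intros Hm Hm'; destruct n as [|n].
  - rewrite !tau_0, pow_O, Rinv_1; lra.
  - eapply Rle_trans; [|apply (tau_diff_scaled_le m m' (S n)); auto; lia].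
    pose proof (INR_S_ge_1 n); pose proof (Rabs_pos (tau m' (S n) - tau m (S n))).
    nra.
Qed.

Lemma inv_4_pow (n : nat) : / 4 ^ n = (/ 4) ^ n.
Proof. now rewrite pow_inv. Qed.

(** The term n = 0 contributes m' - m, the term n = 1 contributes 0, and the remaining ones at most
    (m' - m) / 12 in absolute value. *)
Lemma T_increasing (m m' : R) : 0 < m -> m < m' -> T m < T m'.
Proof.
  intros Hm Hm'.
  assert (E : T m' - T m = Series (fun n => tau m' n - tau m n)).
  { unfold T; rewrite Series_minus; [reflexivity| |];
      apply ex_series_Rabs, ex_series_tau; lra. }
  destruct (Series_tail_le (fun n => tau m' n - tau m n) 1
              ((m' - m) / 16) (/ 4)) as [_ H]; [lra| |].
  { intro k.
    eapply Rle_trans; [apply tau_diff_le; lra|].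
    rewrite Rabs_pos_eq, inv_4_pow by lra.
    simpl; lra. }
  rewrite <- E in H; simpl in H.
  rewrite !tau_0, !tau_1 in H by lra.
  apply Rabs_le_between in H; lra.
Qed.

Lemma W_lipschitz (b m m' : R) : 0 <= b <= 1 -> 0 < m -> 0 < m' ->
  Rabs (W b m' - W b m) <= 3 * Rabs (m' - m).
Proof.
  intros Hb Hm Hm'.
  assert (E : W b m' - W b m =
              Series (fun n => (b + INR n) * (tau m' n - tau m n))).
  { unfold W; rewrite <- Series_minus;
      [apply Series_ext; intro; ring| |];
      apply ex_series_Rabs, ex_series_W; lra. }
  pose proof (Rabs_pos (m' - m)) as Hd.
  destruct (Series_tail_le (fun n => (b + INR n) * (tau m' n - tau m n)) 0
              (Rabs (m' - m) / 2) (/ 4)) as [_ H]; [lra| |].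
  { intro k; rewrite Nat.add_1_l.
    pose proof (tau_diff_scaled_le m m' (S k) Hm Hm' ltac:(lia)) as H1.
    pose proof (tau_diff_le m m' (S k) Hm Hm') as H2.
    rewrite inv_4_pow in H1, H2; cbn [pow] in H1, H2.
    pose proof (INR_S_ge_1 k).
    rewrite Rabs_mult, (Rabs_pos_eq (b + _)) by lra.
    pose proof (Rabs_pos (tau m' (S k) - tau m (S k))).
    nra. }
  rewrite <- E in H; simpl in H; rewrite !tau_0, Rplus_0_r in H.
  assert (Hb' : Rabs (b * (m' - m)) <= Rabs (m' - m)).
  { rewrite Rabs_mult, (Rabs_pos_eq b) by lra; nra. }
  apply Rabs_le_between in H; apply Rabs_le_between in Hb'.
  apply Rabs_le_between; lra.
Qed.

Lemma T_lipschitz (m m' : R) : 0 < m -> 0 < m' ->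
  Rabs (T m' - T m) <= 2 * Rabs (m' - m).
Proof.
  intros Hm Hm'.
  assert (E : T m' - T m = Series (fun n => tau m' n - tau m n)).
  { unfold T; rewrite Series_minus; [reflexivity| |];
      apply ex_series_Rabs, ex_series_tau; lra. }
  destruct (Series_tail_le (fun n => tau m' n - tau m n) 0
              (Rabs (m' - m) / 4) (/ 4)) as [_ H]; [lra| |].
  { intro k.
    eapply Rle_trans; [apply tau_diff_le; lra|].
    rewrite inv_4_pow; simpl; lra. }
  rewrite <- E in H; simpl in H; rewrite !tau_0 in H.
  pose proof (Rabs_pos (m' - m)).
  assert (Hb : Rabs (m' - m) <= Rabs (m' - m)) by lra.
  apply Rabs_le_between in H; apply Rabs_le_between in Hb.
  apply Rabs_le_between; lra.
Qed.

(** * Enclosing the roots of T and W by sign changes *)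

Lemma lipschitz_continuity_pt (f : R -> R) (K x : R) : 0 < K -> 0 < x ->
  (forall y, 0 < y -> Rabs (f y - f x) <= K * Rabs (y - x)) ->
  continuity_pt f x.
Proof.
  intros HK Hx Hf eps Heps.
  exists (Rmin x (eps / (2 * K))); split.
  - apply Rmin_glb_lt; [exact Hx|]; apply Rdiv_lt_0_compat; lra.
  - intros y [_ Hy]; simpl in *; unfold Rdist in *.
    pose proof (Rmin_l x (eps / (2 * K))); pose proof (Rmin_r x (eps / (2 * K))).
    assert (Hyx : Rabs (y - x) < x) by lra.
    apply Rabs_def2 in Hyx.
    eapply Rle_lt_trans; [apply Hf; lra|].
    apply Rle_lt_trans with (K * (eps / (2 * K))).
    + apply Rmult_le_compat_l; lra.
    + replace (K * (eps / (2 * K))) with (eps / 2) by (field; lra); lra.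
Qed.


Lemma T_root : exists ms, 0.225 < ms < 0.226 /\ T ms = 0.
Proof.
  assert (H1 : T (9 / 40) < 0).
  { pose proof (T_tail (9 / 40) 3 ltac:(lra) ltac:(lia)) as H.
    (* Unfolding the recurrence turns the partial sum and the last term into rational numbers, so
       that [lra] can decide the sign. *)
    cbn [sum_f_R0] in H; rewrite !tau_S, tau_0 in H; simpl INR in H.
    match type of H with _ <= Rabs ?x / 3 => rewrite (Rabs_left x) in H by lra end.
    apply Rabs_le_between in H; lra. }
  assert (H2 : 0 < T (113 / 500)).
  { pose proof (T_tail (113 / 500) 3 ltac:(lra) ltac:(lia)) as H.
    cbn [sum_f_R0] in H; rewrite !tau_S, tau_0 in H; simpl INR in H.
    match type of H with _ <= Rabs ?x / 3 => rewrite (Rabs_left x) in H by lra end.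
    apply Rabs_le_between in H; lra. }
  destruct (IVT_interv T (9 / 40) (113 / 500)) as [ms [Hms E]]; [|lra|exact H1|exact H2|].
  - intros x Hx; apply (lipschitz_continuity_pt T 2 x); [lra|lra|].
    intros y Hy; apply T_lipschitz; lra.
  - exists ms; split; [|exact E].
    assert (ms <> 9 / 40) by (intros ->; lra).
    assert (ms <> 113 / 500) by (intros ->; lra).
    lra.
Qed.

(** The point is 0.4376 = 2 - 1.5624, the lower end of the enclosure of nu_0. It also serves as
    lower end of the search interval for every alpha. *)
Lemma W1_neg : W 1 (547 / 1250) < 0.
Proof.
  pose proof (W_tail 1 (547 / 1250) 5 ltac:(lra) ltac:(lra) ltac:(lia)) as H.
  cbn [sum_f_R0] in H; rewrite !tau_S, tau_0 in H; simpl INR in H.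
  match type of H with _ <= Rabs ?x / 3 => rewrite (Rabs_left x) in H by lra end.
  apply Rabs_le_between in H; lra.
Qed.

Lemma W1_pos : 0 < W 1 (4377 / 10000).
Proof.
  pose proof (W_tail 1 (4377 / 10000) 5 ltac:(lra) ltac:(lra) ltac:(lia)) as H.
  cbn [sum_f_R0] in H; rewrite !tau_S, tau_0 in H; simpl INR in H.
  match type of H with _ <= Rabs ?x / 3 => rewrite (Rabs_left x) in H by lra end.
  apply Rabs_le_between in H; lra.
Qed.

Lemma W_root (b lo hi : R) : 0 <= b <= 1 -> 0 < lo < hi ->
  W b lo < 0 -> 0 < W b hi -> exists m, lo < m < hi /\ W b m = 0.
Proof.
  intros Hb Hlo H1 H2.
  destruct (IVT_interv (W b) lo hi) as [m [Hm E]]; [|lra|exact H1|exact H2|].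
  - intros x Hx; apply (lipschitz_continuity_pt (W b) 3 x); [lra|lra|].
    intros y Hy; apply W_lipschitz; lra.
  - exists m; split; [|exact E].
    assert (m <> lo) by (intros ->; lra).
    assert (m <> hi) by (intros ->; lra).
    lra.
Qed.

(** * Convergence of the Euler limit for 1 / Gamma and its functional equation *)

Lemma ln_le_pred (y : R) : 0 < y -> ln y <= y - 1.
Proof.
  intro Hy; rewrite <- (ln_exp (y - 1)).
  apply ln_le; [exact Hy|]; pose proof (exp_ineq1_le (y - 1)); lra.
Qed.

Lemma Rpower_1_minus (a x : R) : 0 < a -> Rpower a x * Rpower a (1 - x) = a.
Proof.
  intro Ha; rewrite <- Rpower_plus, Rplus_minus; now apply Rpower_1.
Qed.

(** Weighted arithmetic-geometric mean inequality: (a + 1)^x a^(1 - x) is at most x (a + 1) + (1 -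
    x) a = x + a. It follows from ln y <= y - 1 at the two quotients by this mean, whose linear
    parts cancel. *)
Lemma Rpower_succ_lower (a x : R) : 0 < a -> 0 < x <= 1 ->
  Rpower (a + 1) x * a <= (x + a) * Rpower a x.
Proof.
  intros Ha Hx.
  pose proof (ln_le_pred ((a + 1) / (x + a)) ltac:(apply Rdiv_lt_0_compat; lra)) as H1.
  pose proof (ln_le_pred (a / (x + a)) ltac:(apply Rdiv_lt_0_compat; lra)) as H2.
  rewrite ln_div in H1, H2 by lra.
  assert (H : x * ln (a + 1) + (1 - x) * ln a <= ln (x + a)).
  { apply (Rmult_le_compat_l x) in H1; [|lra].
    apply (Rmult_le_compat_l (1 - x)) in H2; [|lra].
    assert (E : x * ((a + 1) / (x + a) - 1) + (1 - x) * (a / (x + a) - 1) = 0)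
      by (field; lra).
    lra. }
  assert (H' : Rpower (a + 1) x * Rpower a (1 - x) <= x + a).
  { unfold Rpower; rewrite <- exp_plus, <- (exp_ln (x + a)) by lra.
    destruct H as [H|H]; [left; now apply exp_increasing | right; now rewrite H]. }
  rewrite <- (Rpower_1_minus a x Ha) at 2.
  assert (0 < Rpower a x) by apply exp_pos.
  nra.
Qed.

(** After taking logarithms, ln (1 + x / (a + 1)) <= x / (a + 1) <= x ln ((a + 1) / a), each by ln y
    <= y - 1. *)
Lemma Rpower_succ_upper (a x : R) : 0 < a -> 0 < x ->
  (x + (a + 1)) * Rpower a x <= (a + 1) * Rpower (a + 1) x.
Proof.
  intros Ha Hx.
  pose proof (ln_le_pred ((x + (a + 1)) / (a + 1)) ltac:(apply Rdiv_lt_0_compat; lra)) as H1.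
  pose proof (ln_le_pred (a / (a + 1)) ltac:(apply Rdiv_lt_0_compat; lra)) as H2.
  rewrite ln_div in H1, H2 by lra.
  assert (H : ln (x + (a + 1)) + x * ln a <= ln (a + 1) + x * ln (a + 1)).
  { apply (Rmult_le_compat_l x) in H2; [|lra].
    assert (E : (x + (a + 1)) / (a + 1) - 1 + x * (a / (a + 1) - 1) = 0)
      by (field; lra).
    lra. }
  unfold Rpower.
  rewrite <- (exp_ln (x + (a + 1))) at 1 by lra.
  rewrite <- (exp_ln (a + 1)) at 2 by lra.
  rewrite <- !exp_plus.
  destruct H as [H|H]; [left; now apply exp_increasing | right; now rewrite H].
Qed.

Definition euler_seq (x : R) (n : nat) : R :=
  prod_f_R0 (fun k => x + INR k) n / (INR (fact n) * Rpower (INR n) x).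

Lemma Rpower_pos (a x : R) : 0 < Rpower a x.
Proof. apply exp_pos. Qed.

Lemma prod_f_R0_shift (x : R) (n : nat) :
  prod_f_R0 (fun k => x + INR k) n * (x + INR n + 1) =
  x * prod_f_R0 (fun k => x + 1 + INR k) n.
Proof.
  induction n as [|n IH]; [simpl; ring|].
  cbn [prod_f_R0]; rewrite <- Rmult_assoc, <- IH, !S_INR; ring.
Qed.

Lemma prod_f_R0_pos (x : R) (n : nat) : 0 < x ->
  0 < prod_f_R0 (fun k => x + INR k) n.
Proof.
  intro Hx; induction n as [|n IH]; cbn [prod_f_R0]; [simpl; lra|].
  pose proof (pos_INR (S n)); nra.
Qed.

(** A positive lower bound is what makes the limit of the decreasing sequence positive. Indices
    start at 1 because the power in [euler_seq] has base 0 at index 0. *)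
Lemma euler_seq_lower (x : R) (n : nat) : 0 < x <= 1 -> x <= euler_seq x (S n).
Proof.
  intros Hx.
  (* With base n + 1 in place of n the claim is stronger, holds at n = 0 with equality, and its
     induction step is exactly [Rpower_succ_lower]. *)
  assert (H : forall n, x * INR (fact n) * Rpower (INR n + 1) x
                        <= prod_f_R0 (fun k => x + INR k) n).
  { clear n; induction n as [|n IH].
    - simpl; rewrite Rplus_0_l, Rplus_0_r; unfold Rpower; rewrite ln_1, Rmult_0_r, exp_0; lra.
    - cbn [prod_f_R0].
      rewrite fact_simpl, mult_INR.
      pose proof (Rpower_succ_lower (INR n + 1) x ltac:(pose proof (pos_INR n); lra) Hx) as Hs.
      rewrite S_INR.
      pose proof (INR_fact_lt_0 n); pose proof (pos_INR n).
      assert (0 < x * INR (fact n)) by nra.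
      apply Rle_trans with (x * INR (fact n) * Rpower (INR n + 1) x * (x + (INR n + 1))).
      + nra.
      + apply Rmult_le_compat_r; lra. }
  unfold euler_seq.
  pose proof (INR_fact_lt_0 (S n)); pose proof (INR_S_ge_1 n).
  pose proof (Rpower_pos (INR (S n)) x).
  apply Rmult_le_reg_r with (INR (fact (S n)) * Rpower (INR (S n)) x); [nra|].
  unfold Rdiv; rewrite Rmult_assoc, Rinv_l, Rmult_1_r by nra.
  eapply Rle_trans; [|apply H].
  rewrite Rmult_assoc; apply Rmult_le_compat_l; [lra|].
  apply Rmult_le_compat_l; [lra|].
  apply Rle_Rpower_l; lra.
Qed.

Lemma euler_seq_decr (x : R) (n : nat) : 0 < x ->
  euler_seq x (S (S n)) <= euler_seq x (S n).
Proof.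
  intros Hx; set (k := S n).
  assert (Hk : 1 <= INR k) by apply INR_S_ge_1.
  pose proof (Rpower_succ_upper (INR k) x ltac:(lra) Hx) as H.
  unfold euler_seq; cbn [prod_f_R0].
  rewrite fact_simpl, mult_INR, S_INR.
  pose proof (prod_f_R0_pos x k Hx) as HP.
  set (P := prod_f_R0 _ k) in *.
  pose proof (INR_fact_lt_0 k); set (F := INR (fact k)) in *.
  pose proof (Rpower_pos (INR k) x); pose proof (Rpower_pos (INR k + 1) x).
  set (u := Rpower (INR k) x) in *; set (v := Rpower (INR k + 1) x) in *.
  apply Rdiv_le_l; [apply Rmult_lt_0_compat; nra|].
  replace (P / (F * u) * ((INR k + 1) * F * v))
    with (P * ((INR k + 1) * v / u)) by (field; lra).
  apply Rmult_le_compat_l; [lra|].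
  apply Rmult_le_reg_r with u; [lra|].
  unfold Rdiv; rewrite Rmult_assoc, Rinv_l; lra.
Qed.

Lemma is_lim_seq_frac (x : R) : is_lim_seq (fun n => INR n / (x + INR n + 1)) 1.
Proof.
  assert (H : is_lim_seq (fun n => / (x + 1 + INR n)) 0).
  { replace (Finite 0) with (Rbar_inv p_infty) by reflexivity.
    apply is_lim_seq_inv; [|discriminate].
    eapply is_lim_seq_plus; [apply is_lim_seq_const | apply is_lim_seq_INR | reflexivity]. }
  apply is_lim_seq_ext_loc with (fun n => 1 - (x + 1) * / (x + 1 + INR n)).
  - destruct (INR_unbounded (- x)) as [N HN].
    exists N; intros n Hn; apply le_INR in Hn; field; lra.
  - replace (Finite 1) with (Finite (1 - (x + 1) * 0)) by (f_equal; ring).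
    apply is_lim_seq_minus'; [apply is_lim_seq_const|].
    apply (is_lim_seq_scal_l _ (x + 1) 0); exact H.
Qed.

Lemma is_lim_seq_frac_inv (x : R) : is_lim_seq (fun n => (x + INR n + 1) / INR n) 1.
Proof.
  apply is_lim_seq_ext with (fun n => / (INR n / (x + INR n + 1))).
  - intro n; apply Rinv_div.
  - replace (Finite 1) with (Rbar_inv 1) by (simpl; f_equal; apply Rinv_1).
    apply is_lim_seq_inv; [apply is_lim_seq_frac|].
    intro H; injection H; lra.
Qed.

Lemma euler_seq_shift (x : R) (n : nat) : (1 <= n)%nat ->
  euler_seq x n * ((x + INR n + 1) / INR n) = x * euler_seq (x + 1) n.
Proof.
  intro Hn; apply le_INR in Hn; simpl in Hn.
  unfold euler_seq.
  pose proof (INR_fact_neq_0 n); pose proof (Rpower_pos (INR n) x).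
  rewrite Rpower_plus, Rpower_1 by lra.
  transitivity (prod_f_R0 (fun k => x + INR k) n * (x + INR n + 1)
                / (INR (fact n) * Rpower (INR n) x * INR n)).
  - field; repeat split; lra.
  - rewrite prod_f_R0_shift; field; repeat split; lra.
Qed.

Lemma euler_lim_up (x l : R) : x <> 0 ->
  is_lim_seq (euler_seq x) l -> is_lim_seq (euler_seq (x + 1)) (l / x).
Proof.
  intros Hx H.
  apply is_lim_seq_ext_loc
    with (fun n => euler_seq x n * ((x + INR n + 1) / INR n) * / x).
  - exists 1%nat; intros n Hn; rewrite euler_seq_shift by exact Hn; field; exact Hx.
  - replace (Finite (l / x)) with (Finite (l * 1 * / x))
      by (f_equal; now rewrite Rmult_1_r).
    apply is_lim_seq_mult'; [|apply is_lim_seq_const].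
    apply is_lim_seq_mult'; [exact H | apply is_lim_seq_frac_inv].
Qed.

(** Going down needs no division by x, so it also covers x = 0, where the limit is 0, and the
    interval (-1, 0). *)
Lemma euler_lim_down (x l : R) : -1 < x ->
  is_lim_seq (euler_seq (x + 1)) l -> is_lim_seq (euler_seq x) (x * l).
Proof.
  intros Hx H.
  apply is_lim_seq_ext_loc
    with (fun n => x * euler_seq (x + 1) n * (INR n / (x + INR n + 1))).
  - exists 1%nat; intros n Hn; rewrite <- euler_seq_shift by exact Hn.
    apply le_INR in Hn; simpl in Hn; field; lra.
  - replace (Finite (x * l)) with (Finite (x * l * 1))
      by (f_equal; apply Rmult_1_r).
    apply is_lim_seq_mult'; [|apply is_lim_seq_frac].
    apply (is_lim_seq_scal_l _ x l); exact H.
Qed.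

Lemma euler_lim_exists_unit (x : R) : 0 < x <= 1 ->
  exists l, 0 < l /\ is_lim_seq (euler_seq x) l.
Proof.
  intros Hx.
  destruct (ex_finite_lim_seq_decr (fun n => euler_seq x (S n)) x) as [l Hl].
  - intro n; apply euler_seq_decr; lra.
  - intro n; apply euler_seq_lower; exact Hx.
  - exists l; split; [|now apply is_lim_seq_incr_1].
    apply Rlt_le_trans with x; [lra|].
    refine (is_lim_seq_le _ _ x l _ (is_lim_seq_const x) Hl).
    intro n; apply euler_seq_lower; exact Hx.
Qed.

(** On (0, 1] the sequence is decreasing and bounded below by x; unit steps upwards carry the limit
    to all x > 0. *)
Lemma euler_lim_exists (x : R) : 0 < x ->
  exists l, 0 < l /\ is_lim_seq (euler_seq x) l.
Proof.
  intro Hx.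
  assert (H : forall n x, 0 < x <= INR n + 1 ->
                exists l, 0 < l /\ is_lim_seq (euler_seq x) l).
  { clear x Hx; induction n as [|n IH]; intros x Hx.
    - apply euler_lim_exists_unit; simpl in Hx; lra.
    - destruct (Rle_dec x 1) as [H1|H1]; [apply euler_lim_exists_unit; lra|].
      rewrite S_INR in Hx.
      destruct (IH (x - 1)) as (l & Hl & Hlim); [lra|].
      exists (l / (x - 1)); split; [apply Rdiv_lt_0_compat; lra|].
      replace x with (x - 1 + 1) at 1 by ring.
      apply euler_lim_up; [lra | exact Hlim]. }
  destruct (INR_unbounded x) as [n Hn].
  apply (H n); lra.
Qed.

Lemma rGamma_lim (x l : R) : is_lim_seq (euler_seq x) l -> rGamma x = l.
Proof.
  intro H; change (real (Lim_seq (euler_seq x)) = l).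
  now rewrite (is_lim_seq_unique _ _ H).
Qed.

Lemma rGamma_pos (x : R) : 0 < x -> 0 < rGamma x.
Proof.
  intro Hx; destruct (euler_lim_exists x Hx) as (l & Hl & H).
  now rewrite (rGamma_lim x l H).
Qed.

(** The range x > -1 matters: the first term of J_nu(1) contains [rGamma (nu + 1)], where nu + 1 >
    -1 may be negative. *)
Lemma rGamma_step (x : R) : -1 < x -> rGamma x = x * rGamma (x + 1).
Proof.
  intro Hx; destruct (euler_lim_exists (x + 1)) as (l & _ & H); [lra|].
  rewrite (rGamma_lim _ _ H); apply rGamma_lim, euler_lim_down; assumption.
Qed.

Lemma psi_coef_rGamma (m : R) (n : nat) : 0 < m ->
  (-1) ^ n / INR (fact n) * rGamma (INR n + m) = 4 ^ n * psi_coef m n * rGamma m.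
Proof.
  intro Hm; induction n as [|n IH].
  - simpl; rewrite Rplus_0_l; field.
  - pose proof (INR_S_ge_1 n); pose proof (pos_INR n).
    cbn [psi_coef].
    replace (4 ^ S n * (- psi_coef m n / (4 * INR (S n) * (m + INR n))) * rGamma m)
      with (- (4 ^ n * psi_coef m n * rGamma m) / (INR (S n) * (m + INR n)))
      by (simpl pow; field; lra).
    rewrite <- IH, (rGamma_step (INR n + m)) by lra.
    rewrite fact_simpl, mult_INR.
    replace (INR (S n) + m) with (INR n + m + 1) by (rewrite S_INR; ring).
    simpl pow; field; repeat split; try lra; apply INR_fact_neq_0.
Qed.

(** * Bessel values at 1, and the coefficients of phi, in terms of [psi_coef] *)

Lemma Rpower_half_even (n : nat) : Rpower (1 / 2) (2 * INR n) = / 4 ^ n.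
Proof.
  replace (2 * INR n) with (INR (2 * n)) by (rewrite mult_INR; simpl; ring).
  rewrite Rpower_pow, pow_mult, <- pow_inv by lra; f_equal; simpl; field.
Qed.

Lemma BesselJ_1_T (m : R) : 0 < m ->
  BesselJ (m - 1) 1 = Rpower (1 / 2) (m - 1) * rGamma m / m * T m.
Proof.
  intro Hm; unfold BesselJ, T; rewrite <- Series_scal_l.
  apply Series_ext; intro n.
  replace (INR n + (m - 1) + 1) with (INR n + m) by ring.
  rewrite psi_coef_rGamma, Rpower_plus, Rpower_half_even by exact Hm.
  unfold tau; field; split; [lra|apply pow_nonzero; lra].
Qed.

(** The functional equation puts a factor n + m - 1 in front of each term of the series for
    J_(m-1)(1): its constant part gives T, its part n gives - U. The prefactor is the one of
    [BesselJ_1_T], so it cancels in any linear equation between the two Bessel values. *)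
Lemma BesselJ_1_T_U (m : R) : 0 < m ->
  BesselJ (m - 2) 1
  = Rpower (1 / 2) (m - 1) * rGamma m / m * (2 * ((m - 1) * T m - U m)).
Proof.
  intro Hm; unfold BesselJ, T, U.
  replace (2 * ((m - 1) * Series (tau m) - - Series (fun n => INR n * tau m n)))
    with (2 * ((m - 1) * Series (tau m) + Series (fun n => INR n * tau m n))) by ring.
  rewrite <- Series_scal_l, <- Series_plus, <- !Series_scal_l.
  2: { apply ex_series_scal_R, ex_series_Rabs, ex_series_tau, Hm. }
  2: { apply ex_series_Rabs, ex_series_U, Hm. }
  apply Series_ext; intro n; pose proof (pos_INR n).
  replace (INR n + (m - 2) + 1) with (INR n + m - 1) by ring.
  rewrite rGamma_step by lra.
  replace (INR n + m - 1 + 1) with (INR n + m) by ring.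
  rewrite (Rmult_comm (INR n + m - 1)), <- Rmult_assoc, psi_coef_rGamma by exact Hm.
  replace (2 * INR n + (m - 2)) with (2 * INR n + ((m - 1) + - (1))) by ring.
  rewrite !Rpower_plus, Rpower_half_even, Rpower_Ropp, Rpower_1 by lra.
  unfold tau; field; split; [lra|apply pow_nonzero; lra].
Qed.

Lemma BesselJ_root_iff (m : R) : 0 < m -> (BesselJ (m - 1) 1 = 0 <-> T m = 0).
Proof.
  intro Hm; rewrite BesselJ_1_T by exact Hm.
  assert (HK : 0 < Rpower (1 / 2) (m - 1) * rGamma m / m).
  { apply Rdiv_lt_0_compat; [|exact Hm].
    apply Rmult_lt_0_compat; [apply Rpower_pos | now apply rGamma_pos]. }
  split; intro H; [|rewrite H; ring].
  apply Rmult_integral in H; destruct H; [lra|assumption].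
Qed.

(** Without the common positive prefactor the equation reads (m - 2 + alpha) T = (m - 1) T - U, that
    is (1 - alpha) T = U. *)
Lemma BesselJ_equation_iff (alpha m : R) : 0 < m ->
  ((2 * (m - 2) + 2 * alpha) * BesselJ (m - 1) 1 = BesselJ (m - 2) 1
   <-> W (1 - alpha) m = 0).
Proof.
  intro Hm; rewrite BesselJ_1_T, BesselJ_1_T_U, W_T_U by exact Hm.
  assert (HK : 0 < Rpower (1 / 2) (m - 1) * rGamma m / m).
  { apply Rdiv_lt_0_compat; [|exact Hm].
    apply Rmult_lt_0_compat; [apply Rpower_pos | now apply rGamma_pos]. }
  set (K := Rpower (1 / 2) (m - 1) * rGamma m / m) in *.
  split; intro H.
  - apply Rmult_eq_reg_l with (2 * K); [|lra]; lra.
  - apply Rminus_diag_uniq.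
    transitivity (- 2 * K * ((1 - alpha) * T m - U m)); [ring|].
    rewrite H; ring.
Qed.

Lemma PS_derive_phi_coef (m : R) (n : nat) : 0 < m -> m <> 1 ->
  PS_derive (phi_coef (m - 2)) n = - / (4 * (m - 1)) * psi_coef m n.
Proof.
  intros Hm Hm1; unfold PS_derive, phi_coef, Gamma.
  pose proof (rGamma_pos m Hm) as HG.
  replace (m - 2 + 1) with (m - 1) by ring.
  rewrite (rGamma_step (m - 1)) by lra.
  replace (m - 1 + 1) with m by ring.
  replace (INR (S n) + (m - 2) + 1) with (INR n + m) by (rewrite S_INR; ring).
  pose proof (psi_coef_rGamma m n Hm) as H.
  pose proof (INR_fact_neq_0 n); pose proof (INR_S_ge_1 n).
  assert (4 ^ n <> 0) by (apply pow_nonzero; lra).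
  rewrite fact_simpl, mult_INR; simpl pow.
  transitivity (- / (4 * (m - 1)) * / (4 ^ n * rGamma m)
     * ((-1) ^ n / INR (fact n) * rGamma (INR n + m))).
  - field; repeat split; lra.
  - rewrite H; field; repeat split; lra.
Qed.

Lemma phi_coef_1 (m : R) : 0 < m -> m <> 1 ->
  phi_coef (m - 2) 1 = - / (4 * (m - 1)).
Proof.
  intros Hm Hm1; pose proof (PS_derive_phi_coef m 0 Hm Hm1) as H.
  unfold PS_derive in H; simpl psi_coef in H; simpl INR in H.
  rewrite Rmult_1_l, Rmult_1_r in H; exact H.
Qed.

(** * Algebra of Cauchy products *)

Lemma PS_mult_S (a b : nat -> R) (n : nat) :
  PS_mult a b (S n) = a O * b (S n) + PS_mult (fun k => a (S k)) b n.
Proof. unfold PS_mult; rewrite decomp_sum by lia; reflexivity. Qed.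

Lemma PS_mult_ext (a a' b b' : nat -> R) (n : nat) :
  (forall k, a k = a' k) -> (forall k, b k = b' k) ->
  PS_mult a b n = PS_mult a' b' n.
Proof. intros Ha Hb; apply sum_eq; intros i _; now rewrite Ha, Hb. Qed.

Lemma PS_mult_plus_l (a a' b : nat -> R) (n : nat) :
  PS_mult (fun k => a k + a' k) b n = PS_mult a b n + PS_mult a' b n.
Proof. unfold PS_mult; rewrite <- plus_sum; apply sum_eq; intros; ring. Qed.

Lemma PS_mult_plus_r (a b b' : nat -> R) (n : nat) :
  PS_mult a (fun k => b k + b' k) n = PS_mult a b n + PS_mult a b' n.
Proof. unfold PS_mult; rewrite <- plus_sum; apply sum_eq; intros; ring. Qed.

Lemma PS_mult_scal_l (c : R) (a b : nat -> R) (n : nat) :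
  PS_mult (fun k => c * a k) b n = c * PS_mult a b n.
Proof. unfold PS_mult; rewrite scal_sum; apply sum_eq; intros; ring. Qed.

Lemma PS_mult_scal_r (c : R) (a b : nat -> R) (n : nat) :
  PS_mult a (fun k => c * b k) n = c * PS_mult a b n.
Proof. unfold PS_mult; rewrite scal_sum; apply sum_eq; intros; ring. Qed.

Lemma PS_mult_assoc (a b c : nat -> R) (n : nat) :
  PS_mult (PS_mult a b) c n = PS_mult a (PS_mult b c) n.
Proof.
  revert a; induction n as [|n IH]; intro a; [unfold PS_mult; simpl; ring|].
  rewrite !PS_mult_S, <- IH.
  rewrite (PS_mult_ext (fun k => PS_mult a b (S k))
             (fun k => a O * b (S k) + PS_mult (fun j => a (S j)) b k) c c)
    by (try reflexivity; intro k; apply PS_mult_S).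
  rewrite PS_mult_plus_l, (PS_mult_scal_l (a O) (fun k => b (S k))).
  unfold PS_mult at 1; simpl sum_f_R0; ring.
Qed.

(** The Leibniz rule for the operator z d/dz, which multiplies the n-th coefficient by n. *)
Lemma PS_mult_euler (a b : nat -> R) (n : nat) :
  INR n * PS_mult a b n =
  PS_mult (fun k => INR k * a k) b n + PS_mult a (fun k => INR k * b k) n.
Proof.
  unfold PS_mult; rewrite scal_sum, <- plus_sum; apply sum_eq; intros i Hi.
  rewrite (minus_INR n i Hi); ring.
Qed.

(** * The Riccati recurrence: bounds, monotonicity, and the identity h psi = - z psi' *)

(* The series solution of the Riccati equation
   [x h' + (m - 1) h = h ^ 2 + x / 4], which [h = - x psi' / psi] satisfies;
   its coefficients are the Rayleigh sums of Bessel zeros. *)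
Fixpoint rayleigh_upto (m : R) (N : nat) : nat -> R :=
  match N with
  | O => fun _ => 0
  | S N' => fun k =>
      if Nat.eqb k N
      then (PS_mult (rayleigh_upto m N') (rayleigh_upto m N') N
            + (if Nat.eqb N 1 then / 4 else 0)) / (INR N + m - 1)
      else rayleigh_upto m N' k
  end.

Definition rayleigh (m : R) (n : nat) : R := rayleigh_upto m n n.

Lemma rayleigh_0 (m : R) : rayleigh m 0 = 0.
Proof. reflexivity. Qed.

Lemma rayleigh_upto_stable (m : R) (N k : nat) : (k <= N)%nat ->
  rayleigh_upto m N k = rayleigh m k.
Proof.
  induction N as [|N IH]; intro Hk.
  - replace k with O by lia; reflexivity.
  - destruct (Nat.eq_dec k (S N)) as [->|Hne]; [reflexivity|].
    cbn [rayleigh_upto]; rewrite (proj2 (Nat.eqb_neq _ _) Hne); apply IH; lia.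
Qed.

(** The definition convolves a table filled only below n. This agrees with the full convolution
    because the two end terms carry the factor [rayleigh m 0 = 0]. *)
Lemma rayleigh_eq (m : R) (n : nat) : 0 < m ->
  (INR n + m - 1) * rayleigh m n
  = PS_mult (rayleigh m) (rayleigh m) n + (if Nat.eqb n 1 then / 4 else 0).
Proof.
  intro Hm; destruct n as [|n].
  - unfold PS_mult; simpl; rewrite rayleigh_0; ring.
  - unfold rayleigh at 1; cbn [rayleigh_upto]; rewrite Nat.eqb_refl.
    pose proof (INR_S_ge_1 n).
    replace (PS_mult (rayleigh_upto m n) (rayleigh_upto m n) (S n))
      with (PS_mult (rayleigh m) (rayleigh m) (S n)).
    { field; lra. }
    apply sum_eq; intros i Hi.
    assert (H0 : rayleigh_upto m n 0 = 0)
      by (rewrite rayleigh_upto_stable by lia; reflexivity).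
    destruct (Nat.eq_dec i 0) as [->|Hi0]; [now rewrite H0, rayleigh_0, !Rmult_0_l|].
    destruct (Nat.eq_dec i (S n)) as [->|HiS].
    { now rewrite Nat.sub_diag, H0, rayleigh_0, !Rmult_0_r. }
    rewrite !rayleigh_upto_stable by lia; reflexivity.
Qed.

(** Vanishing at 0 removes both end terms, so only indices below n have to be compared; this is the
    shape that strong induction on the recurrence supplies. *)
Lemma PS_mult_inner_le (f g f' g' : nat -> R) (n : nat) :
  f O = 0 -> g O = 0 -> f' O = 0 -> g' O = 0 ->
  (forall k, (k < n)%nat -> 0 <= f k <= f' k) ->
  (forall k, (k < n)%nat -> 0 <= g k <= g' k) ->
  0 <= PS_mult f g n <= PS_mult f' g' n.
Proof.
  intros Hf0 Hg0 Hf0' Hg0' Hf Hg.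
  assert (H : forall i, (i <= n)%nat ->
    0 <= f i * g (n - i)%nat <= f' i * g' (n - i)%nat).
  { intros i Hi.
    destruct (Nat.eq_dec i 0) as [->|Hi0]; [rewrite Hf0, Hf0'; lra|].
    destruct (Nat.eq_dec i n) as [->|Hin]; [rewrite Nat.sub_diag, Hg0, Hg0'; lra|].
    assert (H1 : 0 <= f i <= f' i) by (apply Hf; lia).
    assert (H2 : 0 <= g (n - i)%nat <= g' (n - i)%nat) by (apply Hg; lia).
    split; [apply Rmult_le_pos; lra | apply Rmult_le_compat; lra]. }
  split; [|apply sum_Rle; intros i Hi; now apply H].
  assert (Hz : 0 = sum_f_R0 (fun _ => 0) n)
    by (rewrite sum_cte; ring).
  rewrite Hz; apply sum_Rle; intros i Hi; now apply H.
Qed.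

Lemma PS_mult_pow_inner (q : R) (n : nat) :
  let g := fun k => match k with O => 0 | S _ => q ^ k end in
  PS_mult g g (S n) = INR n * q ^ S n.
Proof.
  intro g; unfold PS_mult; rewrite decomp_sum by lia; cbn [pred].
  destruct n as [|n]; [simpl; ring|].
  rewrite tech5, Nat.sub_diag.
  rewrite (sum_eq _ (fun _ => q ^ S (S n))).
  - rewrite sum_cte, S_INR; unfold g; ring.
  - intros i Hi; unfold g.
    destruct (S (S n) - S i)%nat as [|j] eqn:E; [lia|].
    rewrite <- pow_add; f_equal; lia.
Qed.

(** Write q = 1 / (4 m), the value at n = 1. At n + 1 the convolution has n inner terms, each at
    most q^(n+1), and the inhomogeneity is at most m q^(n+1), with equality at n = 0. Together they
    give (n + m) q^(n+1), which the factor n + m on the left divides out. *)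
Lemma rayleigh_bounds (m : R) (n : nat) : 0 < m ->
  0 <= rayleigh m n <= (/ (4 * m)) ^ n.
Proof.
  intro Hm; induction n as [n IH] using lt_wf_ind.
  assert (Hq : 0 < / (4 * m)) by (apply Rinv_0_lt_compat; lra).
  set (q := / (4 * m)) in *.
  destruct n as [|n]; [rewrite rayleigh_0; simpl; lra|].
  pose proof (rayleigh_eq m (S n) Hm) as E.
  pose proof (pos_INR n) as Hn.
  replace (INR (S n) + m - 1) with (INR n + m) in E by (rewrite S_INR; ring).
  set (g := fun k => match k with O => 0 | S _ => q ^ k end).
  assert (HP : 0 <= PS_mult (rayleigh m) (rayleigh m) (S n) <= PS_mult g g (S n)).
  { apply PS_mult_inner_le; try reflexivity;
      intros [|k] Hk; try (rewrite rayleigh_0; simpl; lra); now apply IH. }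
  unfold g in HP; rewrite PS_mult_pow_inner in HP.
  pose proof (pow_lt q (S n) Hq) as Hqn.
  assert (Hd : 0 <= (if Nat.eqb (S n) 1 then / 4 else 0) <= m * q ^ S n).
  { destruct n as [|n]; simpl.
    - rewrite Rmult_1_r; unfold q.
      replace (m * / (4 * m)) with (/ 4) by (field; lra); lra.
    - split; [lra|]; apply Rmult_le_pos; [lra | left; exact Hqn]. }
  split.
  - apply Rmult_le_reg_l with (INR n + m); lra.
  - apply Rmult_le_reg_l with (INR n + m); lra.
Qed.

Lemma rayleigh_1 (m : R) : 0 < m -> rayleigh m 1 = / (4 * m).
Proof.
  intro Hm; pose proof (rayleigh_eq m 1 Hm) as E.
  unfold PS_mult in E; cbn [sum_f_R0 Nat.sub Nat.eqb] in E.
  rewrite rayleigh_0 in E; simpl INR in E.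
  apply Rmult_eq_reg_l with m; [|lra].
  replace (m * / (4 * m)) with (/ 4) by (field; lra); lra.
Qed.

(** As m grows, the divisor n + m - 1 grows, while the convolution shrinks by induction. *)
Lemma rayleigh_decr (m m' : R) (n : nat) : 0 < m -> m <= m' ->
  rayleigh m' n <= rayleigh m n.
Proof.
  intros Hm Hm'; induction n as [n IH] using lt_wf_ind.
  destruct n as [|n]; [rewrite !rayleigh_0; lra|].
  pose proof (rayleigh_eq m (S n) Hm) as E.
  pose proof (rayleigh_eq m' (S n) ltac:(lra)) as E'.
  assert (HP : 0 <= PS_mult (rayleigh m') (rayleigh m') (S n)
                 <= PS_mult (rayleigh m) (rayleigh m) (S n)).
  { apply PS_mult_inner_le; try apply rayleigh_0;
      (intros k Hk; split; [apply rayleigh_bounds; lra | now apply IH]). }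
  pose proof (pos_INR n); rewrite S_INR in E, E'.
  pose proof (proj1 (rayleigh_bounds m (S n) Hm)).
  pose proof (proj1 (rayleigh_bounds m' (S n) ltac:(lra))).
  apply Rmult_le_reg_l with (INR n + 1 + m - 1); nra.
Qed.

(** With D = z d/dz, these are the coefficients of D^2 psi + (m - 1) D psi + (z / 4) psi = 0;
    [delta] is the coefficient sequence of z / 4. *)
Lemma psi_coef_ode (m : R) (n : nat) : 0 < m ->
  let delta := fun k => if Nat.eqb k 1 then / 4 else 0 in
  INR n * (INR n * psi_coef m n) + (m - 1) * (INR n * psi_coef m n)
  + PS_mult delta (psi_coef m) n = 0.
Proof.
  intros Hm delta.
  destruct n as [|n]; [unfold PS_mult, delta; simpl; ring|].
  assert (Ed : PS_mult (fun k => delta (S k)) (psi_coef m) n = / 4 * psi_coef m n).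
  { destruct n as [|n]; [unfold PS_mult, delta; simpl; ring|].
    rewrite PS_mult_S; unfold PS_mult.
    rewrite (sum_eq _ (fun _ => 0)), sum_cte.
    - unfold delta; simpl Nat.eqb; cbn iota; ring.
    - intros i _; unfold delta; simpl Nat.eqb; cbn iota; ring. }
  rewrite PS_mult_S, Ed; unfold delta; cbn [Nat.eqb psi_coef].
  rewrite S_INR; pose proof (pos_INR n); field; lra.
Qed.

(** Newton's identities in coefficient form. With D = z d/dz, the Riccati equation and the equation
    of psi make the defect e = h psi + D psi satisfy D e + (m - 1) e = h e. As h(0) = 0, the right
    side at n involves only earlier coefficients of e, and e(0) = 0, so e vanishes. *)
Lemma rayleigh_newton (m : R) (n : nat) : 0 < m ->
  PS_mult (rayleigh m) (psi_coef m) n = - (INR n * psi_coef m n).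
Proof.
  intro Hm.
  set (r := rayleigh m); set (c := psi_coef m).
  set (e := fun n => PS_mult r c n + INR n * c n).
  set (delta := fun k => if Nat.eqb k 1 then / 4 else 0).
  assert (He : forall n, (INR n + m - 1) * e n = PS_mult r e n).
  { clear n; intro n; unfold e at 2.
    rewrite PS_mult_plus_r, <- PS_mult_assoc.
    rewrite (PS_mult_ext (PS_mult r r)
      (fun k => (INR k * r k + (m - 1) * r k) + (-1) * delta k) c c).
    2: { intro k; pose proof (rayleigh_eq m k Hm) as H.
         fold r in H; change (if Nat.eqb k 1 then / 4 else 0) with (delta k) in H; lra. }
    2: reflexivity.
    rewrite !PS_mult_plus_l, !PS_mult_scal_l.
    pose proof (psi_coef_ode m n Hm) as Ho; cbv zeta in Ho; fold delta c in Ho.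
    pose proof (PS_mult_euler r c n) as Hd.
    unfold e; lra. }
  assert (Hz : e n = 0).
  { induction n as [n IH] using lt_wf_ind.
    destruct n as [|n].
    - unfold e, PS_mult; simpl; unfold r; rewrite rayleigh_0; ring.
    - specialize (He (S n)).
      rewrite PS_mult_S in He; unfold r at 1 in He; rewrite rayleigh_0, Rmult_0_l, Rplus_0_l in He.
      unfold PS_mult in He.
      rewrite (sum_eq _ (fun _ => 0)), sum_cte in He.
      + pose proof (INR_S_ge_1 n).
        apply Rmult_eq_reg_l with (INR (S n) + m - 1); lra.
      + intros i Hi; rewrite IH by lia; ring. }
  unfold e in Hz; lra.
Qed.

(** * The value h(1) as a function of m *)

Definition rayleigh_sum (m : R) : R := Series (rayleigh m).

Lemma ex_series_rayleigh (m : R) : / 4 < m ->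
  ex_series (fun n => Rabs (rayleigh m n)).
Proof.
  intro Hm.
  apply ex_series_le_R with (b := fun n => (/ (4 * m)) ^ n).
  - intro n; rewrite Rabs_Rabsolu.
    pose proof (rayleigh_bounds m n ltac:(lra)).
    rewrite Rabs_pos_eq; lra.
  - exists (/ (1 - / (4 * m))); apply is_series_geom.
    assert (0 < / (4 * m)) by (apply Rinv_0_lt_compat; lra).
    rewrite Rabs_pos_eq by lra.
    rewrite <- Rinv_1; apply Rinv_lt_contravar; lra.
Qed.

Lemma rayleigh_sum_T (m : R) : / 4 < m -> rayleigh_sum m * T m = U m.
Proof.
  intro Hm.
  assert (H : is_series (PS_mult (rayleigh m) (tau m)) (rayleigh_sum m * T m)).
  { apply is_series_mult.
    - apply Series_correct, ex_series_Rabs, ex_series_rayleigh, Hm.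
    - apply Series_correct, ex_series_Rabs, ex_series_tau; lra.
    - now apply ex_series_rayleigh.
    - apply ex_series_tau; lra. }
  rewrite <- (is_series_unique _ _ H).
  unfold U; rewrite <- Series_opp.
  apply Series_ext; intro n.
  unfold tau; rewrite (PS_mult_scal_r m), rayleigh_newton by lra; ring.
Qed.

Lemma rayleigh_sum_pos (m : R) : / 4 < m -> 0 < rayleigh_sum m.
Proof.
  intro Hm; unfold rayleigh_sum.
  pose proof (ex_series_Rabs _ (ex_series_rayleigh m Hm)) as Hex.
  rewrite Series_incr_1, rayleigh_0, Rplus_0_l by exact Hex.
  rewrite Series_incr_1 by (now apply (ex_series_incr_1 (rayleigh m))).
  rewrite rayleigh_1 by lra.
  assert (0 < / (4 * m)) by (apply Rinv_0_lt_compat; lra).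
  assert (0 <= Series (fun k => rayleigh m (S (S k)))).
  { rewrite <- (Rmult_0_l (Series (fun k => rayleigh m (S (S k))))), <- Series_scal_l.
    apply Series_le.
    - intro n; pose proof (rayleigh_bounds m (S (S n)) ltac:(lra)); lra.
    - apply (ex_series_incr_1 (fun k => rayleigh m (S k))), (ex_series_incr_1 (rayleigh m)), Hex. }
  lra.
Qed.

(** All coefficients decrease weakly; strictness comes from the first one, 1 / (4 m). *)
Lemma rayleigh_sum_decr (m m' : R) : / 4 < m -> m < m' ->
  rayleigh_sum m' < rayleigh_sum m.
Proof.
  intros Hm Hm'; unfold rayleigh_sum.
  pose proof (ex_series_Rabs _ (ex_series_rayleigh m Hm)) as Hex.
  pose proof (ex_series_Rabs _ (ex_series_rayleigh m' ltac:(lra))) as Hex'.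
  assert (Hex1 := Hex); assert (Hex1' := Hex').
  apply ex_series_incr_1 in Hex1; apply ex_series_incr_1 in Hex1'.
  rewrite (Series_incr_1 (rayleigh m)), (Series_incr_1 (rayleigh m')) by assumption.
  rewrite (Series_incr_1 (fun k => rayleigh m (S k))), (Series_incr_1 (fun k => rayleigh m' (S k)))
    by assumption.
  rewrite !rayleigh_0, !rayleigh_1 by lra.
  assert (/ (4 * m') < / (4 * m)) by (apply Rinv_lt_contravar; nra).
  assert (Series (fun k => rayleigh m' (S (S k))) <= Series (fun k => rayleigh m (S (S k)))).
  { apply Series_le.
    - intro n; split; [apply rayleigh_bounds | apply rayleigh_decr]; lra.
    - now apply (ex_series_incr_1 (fun k => rayleigh m (S k))). }
  lra.
Qed.

(** * Absolutely convergent complex series and power series with real coefficients *)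

Lemma im_le_Cmod (z : C) : Rabs (Im z) <= Cmod z.
Proof. eapply Rle_trans; [apply Rmax_r | apply Rmax_Cmod]. Qed.

Lemma ex_series_Re (u : nat -> C) :
  ex_series (fun n => Cmod (u n)) -> ex_series (fun n => Re (u n)).
Proof. apply ex_series_le_R; intro n; apply re_le_Cmod. Qed.

Lemma ex_series_Im (u : nat -> C) :
  ex_series (fun n => Cmod (u n)) -> ex_series (fun n => Im (u n)).
Proof. apply ex_series_le_R; intro n; apply im_le_Cmod. Qed.

Lemma CSeries_ext (u v : nat -> C) :
  (forall n, u n = v n) -> CSeries u = CSeries v.
Proof.
  intro H; unfold CSeries; f_equal; apply Series_ext; intro n; now rewrite H.
Qed.

Lemma CSeries_plus (u v : nat -> C) :
  ex_series (fun n => Cmod (u n)) -> ex_series (fun n => Cmod (v n)) ->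
  CSeries (fun n => u n + v n)%C = (CSeries u + CSeries v)%C.
Proof.
  intros Hu Hv; unfold CSeries, Cplus; cbn [fst snd]; f_equal;
    rewrite <- Series_plus; try reflexivity;
    now (apply ex_series_Re || apply ex_series_Im).
Qed.

Lemma CSeries_scal (c : C) (u : nat -> C) :
  ex_series (fun n => Cmod (u n)) ->
  CSeries (fun n => c * u n)%C = (c * CSeries u)%C.
Proof.
  intro Hu; pose proof (ex_series_Re u Hu); pose proof (ex_series_Im u Hu).
  unfold CSeries, Cmult; cbn [fst snd]; f_equal.
  - rewrite <- !Series_scal_l, <- Series_minus by now apply ex_series_scal_R.
    reflexivity.
  - rewrite <- !Series_scal_l, <- Series_plus by now apply ex_series_scal_R.
    reflexivity.
Qed.

Lemma CSeries_incr_1 (u : nat -> C) :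
  ex_series (fun n => Cmod (u n)) ->
  CSeries u = (u O + CSeries (fun n => u (S n)))%C.
Proof.
  intro Hu; unfold CSeries, Cplus; cbn [fst snd]; f_equal.
  - apply Series_incr_1; now apply ex_series_Re.
  - apply Series_incr_1; now apply ex_series_Im.
Qed.

(** Componentwise bounds would lose a constant. Multiplying the terms by the conjugate of the sum s
    makes the total equal to |s|^2, which is real, so the real series of real parts gives the sharp
    bound after division by |s|. *)
Lemma Cmod_CSeries_le (u : nat -> C) :
  ex_series (fun n => Cmod (u n)) ->
  Cmod (CSeries u) <= Series (fun n => Cmod (u n)).
Proof.
  intro Hu.
  set (s := CSeries u).
  destruct (Req_dec (Cmod s) 0) as [H0|H0].
  { rewrite H0, <- (Rmult_0_l (Series (fun n => Cmod (u n)))), <- Series_scal_l.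
    apply Series_le; [intro n; pose proof (Cmod_ge_0 (u n)); lra | exact Hu]. }
  assert (Hpos : 0 < Cmod s) by (pose proof (Cmod_ge_0 s); lra).
  apply Rmult_le_reg_l with (Cmod s); [exact Hpos|].
  rewrite <- Series_scal_l.
  assert (E : Cmod s * Cmod s = Re (CSeries (fun n => Cconj s * u n)%C)).
  { rewrite CSeries_scal by exact Hu; fold s.
    replace (Cmod s * Cmod s) with (Cmod s ^ 2) by ring.
    rewrite Cmod2_alt; destruct s as [x y]; simpl; ring. }
  rewrite E; unfold CSeries; cbn [Re fst].
  assert (Hb : forall n, Rabs (Re (Cconj s * u n)%C) <= Cmod s * Cmod (u n)).
  { intro n; eapply Rle_trans; [apply re_le_Cmod|].
    rewrite Cmod_mult, Cmod_conj; lra. }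
  assert (Hex : ex_series (fun n => Cmod s * Cmod (u n)))
    by now apply ex_series_scal_R.
  assert (Hexa : ex_series (fun n => Rabs (Re (Cconj s * u n)%C))).
  { apply ex_series_le_R with (2 := Hex); intro n; rewrite Rabs_Rabsolu; apply Hb. }
  eapply Rle_trans; [apply Rle_abs|].
  eapply Rle_trans; [apply Series_Rabs, Hexa|].
  apply Series_le; [|exact Hex].
  intro n; split; [apply Rabs_pos | apply Hb].
Qed.

Definition CPSeries (a : nat -> R) (z : C) : C :=
  CSeries (fun n => (RtoC (a n) * Cpow z n)%C).

Definition CPS_abs_cv (a : nat -> R) (r : R) : Prop :=
  ex_series (fun n => Rabs (a n) * r ^ n).

Lemma Cmod_CPS_term (a : nat -> R) (z : C) (n : nat) :
  Cmod (RtoC (a n) * Cpow z n) = Rabs (a n) * Cmod z ^ n.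
Proof. now rewrite Cmod_mult, Cmod_R, Cmod_pow. Qed.

Lemma ex_series_CPS (a : nat -> R) (z : C) :
  CPS_abs_cv a (Cmod z) -> ex_series (fun n => Cmod (RtoC (a n) * Cpow z n)).
Proof.
  apply ex_series_ext_R; intro n; symmetry; apply Cmod_CPS_term.
Qed.

Lemma CPSeries_ext (a b : nat -> R) (z : C) :
  (forall n, a n = b n) -> CPSeries a z = CPSeries b z.
Proof. intro H; apply CSeries_ext; intro n; now rewrite H. Qed.

Lemma CPSeries_scal (c : R) (a : nat -> R) (z : C) :
  CPS_abs_cv a (Cmod z) ->
  CPSeries (fun n => c * a n) z = (RtoC c * CPSeries a z)%C.
Proof.
  intro Ha; unfold CPSeries.
  rewrite <- CSeries_scal by now apply ex_series_CPS.
  apply CSeries_ext; intro n; rewrite RtoC_mult; ring.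
Qed.

Lemma CPSeries_real (a : nat -> R) (x : R) :
  CPSeries a (RtoC x) = RtoC (PSeries a x).
Proof.
  unfold CPSeries.
  rewrite (CSeries_ext _ (fun n => RtoC (a n * x ^ n)))
    by (intro n; now rewrite Cpow_RtoC, RtoC_mult).
  unfold CSeries, PSeries; apply injective_projections; cbn [fst snd RtoC Re Im].
  - reflexivity.
  - rewrite (Series_ext _ (fun n => 0 * a n)) by (intro; ring).
    rewrite Series_scal_l; ring.
Qed.

Lemma PS_mult_Cpow_Re (a b : nat -> R) (z : C) (n : nat) :
  PS_mult a b n * Re (z ^ n)%C =
  PS_mult (fun k => Re (RtoC (a k) * z ^ k)%C) (fun k => Re (RtoC (b k) * z ^ k)%C) n
  - PS_mult (fun k => Im (RtoC (a k) * z ^ k)%C) (fun k => Im (RtoC (b k) * z ^ k)%C) n.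
Proof.
  unfold PS_mult; rewrite <- minus_sum, Rmult_comm, scal_sum; apply sum_eq; intros k Hk.
  assert (E : (z ^ n = z ^ k * z ^ (n - k))%C)
    by (rewrite <- Cpow_add_r; f_equal; lia).
  rewrite E; simpl; ring.
Qed.

Lemma PS_mult_Cpow_Im (a b : nat -> R) (z : C) (n : nat) :
  PS_mult a b n * Im (z ^ n)%C =
  PS_mult (fun k => Re (RtoC (a k) * z ^ k)%C) (fun k => Im (RtoC (b k) * z ^ k)%C) n
  + PS_mult (fun k => Im (RtoC (a k) * z ^ k)%C) (fun k => Re (RtoC (b k) * z ^ k)%C) n.
Proof.
  unfold PS_mult; rewrite <- plus_sum, Rmult_comm, scal_sum; apply sum_eq; intros k Hk.
  assert (E : (z ^ n = z ^ k * z ^ (n - k))%C)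
    by (rewrite <- Cpow_add_r; f_equal; lia).
  rewrite E; simpl; ring.
Qed.

(** Since z^n = z^k z^(n-k), the real and imaginary parts of the product series combine four real
    Cauchy products, to each of which the theorem for absolutely convergent real series applies. *)
Lemma CPSeries_mult (a b : nat -> R) (z : C) :
  CPS_abs_cv a (Cmod z) -> CPS_abs_cv b (Cmod z) ->
  (CPSeries a z * CPSeries b z)%C = CPSeries (PS_mult a b) z.
Proof.
  intros Ha Hb.
  assert (HRe : forall c, CPS_abs_cv c (Cmod z) ->
    ex_series (fun n => Rabs (Re (RtoC (c n) * z ^ n)%C))).
  { intros c Hc; eapply ex_series_le_R; [|exact (ex_series_CPS _ _ Hc)].
    intro n; rewrite Rabs_Rabsolu; apply re_le_Cmod. }
  assert (HIm : forall c, CPS_abs_cv c (Cmod z) ->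
    ex_series (fun n => Rabs (Im (RtoC (c n) * z ^ n)%C))).
  { intros c Hc; eapply ex_series_le_R; [|exact (ex_series_CPS _ _ Hc)].
    intro n; rewrite Rabs_Rabsolu; apply im_le_Cmod. }
  assert (Hprod : forall f g, ex_series (fun n => Rabs (f n)) ->
    ex_series (fun n => Rabs (g n)) -> is_series (PS_mult f g) (Series f * Series g)).
  { intros f g Hf Hg; apply is_series_mult; try assumption;
      apply Series_correct; now apply ex_series_Rabs. }
  unfold CPSeries, CSeries, Cmult at 1; cbn [fst snd].
  apply injective_projections; cbn [fst snd]; symmetry; apply is_series_unique.
  - eapply is_series_ext;
      [|exact (is_series_minus _ _ _ _ (Hprod _ _ (HRe a Ha) (HRe b Hb))
                                       (Hprod _ _ (HIm a Ha) (HIm b Hb)))].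
    intro n; refine (eq_trans (eq_sym (PS_mult_Cpow_Re a b z n)) _).
    unfold Re, Im, Cmult, RtoC; cbn [fst snd]; ring.
  - eapply is_series_ext;
      [|exact (is_series_plus _ _ _ _ (Hprod _ _ (HRe a Ha) (HIm b Hb))
                                      (Hprod _ _ (HIm a Ha) (HRe b Hb)))].
    intro n; refine (eq_trans (eq_sym (PS_mult_Cpow_Im a b z n)) _).
    unfold Re, Im, Cmult, RtoC; cbn [fst snd]; ring.
Qed.

(** * Complex differentiation of entire power series *)

Definition entire (a : nat -> R) : Prop := CV_radius a = p_infty.

Lemma entire_abs_cv (a : nat -> R) (r : R) : entire a -> 0 <= r -> CPS_abs_cv a r.
Proof.
  intros Ha Hr.
  assert (H : ex_series (fun n => Rabs (a n * r ^ n))).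
  { apply CV_disk_inside; now rewrite Ha. }
  revert H; apply ex_series_ext_R; intro n.
  rewrite Rabs_mult, (Rabs_pos_eq (r ^ n)); [reflexivity | now apply pow_le].
Qed.

Lemma entire_derive (a : nat -> R) : entire a -> entire (PS_derive a).
Proof. unfold entire; now rewrite CV_radius_derive. Qed.

Lemma INR_le_pow_4 (n : nat) : INR n <= 4 ^ n.
Proof.
  induction n as [|n IH]; [simpl; lra|].
  rewrite S_INR; simpl pow; pose proof (pow_R1_Rle 4 n ltac:(lra)); lra.
Qed.

(** The remainders satisfy R_(n+1) = (z + h) R_n + n h^2 z^(n-1). The factor 4^n in the bound
    absorbs n at each step, and the result is still a geometric sequence, hence summable against
    entire coefficients. *)
Lemma Cpow_taylor_le (z h : C) (n : nat) : Cmod h <= 1 ->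
  Cmod ((z + h) ^ n - z ^ n - RtoC (INR n) * h * z ^ pred n)%C
    <= Cmod h ^ 2 * (4 * (Cmod z + 1)) ^ n.
Proof.
  intros Hh.
  pose proof (Cmod_ge_0 z) as Hz; pose proof (Cmod_ge_0 h) as Hh0.
  set (p := Cmod z + 1).
  induction n as [|n IH].
  - replace ((z + h) ^ 0 - z ^ 0 - RtoC (INR 0) * h * z ^ pred 0)%C with (RtoC 0)
      by (simpl; ring).
    rewrite Cmod_0; simpl; nra.
  - replace ((z + h) ^ S n - z ^ S n - RtoC (INR (S n)) * h * z ^ pred (S n))%C
      with ((z + h) * ((z + h) ^ n - z ^ n - RtoC (INR n) * h * z ^ pred n)
            + RtoC (INR n) * h ^ 2 * z ^ pred n)%C.
    2: { rewrite S_INR, RtoC_plus; destruct n as [|n]; simpl pred;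
           [simpl; ring | rewrite !(Cpow_S _ (S n)), !(Cpow_S _ n); ring]. }
    eapply Rle_trans; [apply Cmod_triangle|].
    rewrite !Cmod_mult, !Cmod_pow, Cmod_R, (Rabs_pos_eq _ (pos_INR n)).
    assert (H1 : Cmod (z + h)%C <= p)
      by (eapply Rle_trans; [apply Cmod_triangle|]; unfold p; lra).
    assert (H2 : Cmod z ^ pred n <= p ^ n).
    { apply Rle_trans with (p ^ pred n).
      - apply pow_incr; unfold p; lra.
      - apply Rle_pow; [unfold p; lra | lia]. }
    assert (H3 : 0 <= Cmod z ^ pred n) by (now apply pow_le).
    pose proof (INR_le_pow_4 n) as H4; pose proof (pos_INR n).
    assert (Hp : 1 <= p) by (unfold p; lra).
    assert (Hpn : 1 <= p ^ n) by now apply pow_R1_Rle.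
    assert (H4n : 1 <= 4 ^ n) by (apply pow_R1_Rle; lra).
    assert (B1 : Cmod (z + h)%C * Cmod ((z + h) ^ n - z ^ n - RtoC (INR n) * h * z ^ pred n)%C
                 <= p * (Cmod h ^ 2 * (4 * p) ^ n)).
    { apply Rmult_le_compat; try apply Cmod_ge_0; assumption. }
    assert (B2 : INR n * Cmod h ^ 2 * Cmod z ^ pred n <= Cmod h ^ 2 * (4 * p) ^ n).
    { rewrite (Rmult_comm (INR n)), Rmult_assoc, Rpow_mult_distr.
      apply Rmult_le_compat_l; [nra|].
      apply Rmult_le_compat; lra. }
    assert (B3 : 0 <= Cmod h ^ 2 * (4 * p) ^ n).
    { apply Rmult_le_pos; [nra|]; apply pow_le; lra. }
    simpl pow in *; nra.
Qed.

Lemma CPSeries_taylor_le (a : nat -> R) (z h : C) : entire a -> Cmod h <= 1 ->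
  Cmod (CPSeries a (z + h) - CPSeries a z - h * CPSeries (PS_derive a) z)%C
  <= Cmod h ^ 2 * Series (fun n => Rabs (a n) * (4 * (Cmod z + 1)) ^ n).
Proof.
  intros Ha Hh.
  pose proof (Cmod_ge_0 z) as Hz; pose proof (Cmod_ge_0 h) as Hh0.
  assert (Hzh := ex_series_CPS a (z + h)%C (entire_abs_cv a _ Ha (Cmod_ge_0 _))).
  assert (Hz' := ex_series_CPS a z (entire_abs_cv a _ Ha Hz)).
  assert (Hd := ex_series_CPS (PS_derive a) z
                  (entire_abs_cv _ _ (entire_derive a Ha) Hz)).
  (* The derived series is re-indexed so that its n-th term pairs with [a n]; the added term at 0
     vanishes through [INR 0], whatever [pred 0] is. *)
  set (d := fun n => (RtoC (INR n * a n) * z ^ pred n)%C).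
  assert (Hd' : ex_series (fun n => Cmod (d n)))
    by (apply (ex_series_incr_1 (fun n => Cmod (d n))); exact Hd).
  assert (Ed : CPSeries (PS_derive a) z = CSeries d).
  { rewrite (CSeries_incr_1 d Hd'); unfold d at 1; simpl INR.
    rewrite Rmult_0_l, Cmult_0_l, Cplus_0_l; reflexivity. }
  assert (Hscal : forall (c : C) u, ex_series (fun n => Cmod (u n)) ->
            ex_series (fun n => Cmod (c * u n)%C)).
  { intros c u Hu.
    apply ex_series_ext_R with (fun n => Cmod c * Cmod (u n));
      [intro n; now rewrite Cmod_mult | now apply ex_series_scal_R]. }
  assert (Hplus : forall u v, ex_series (fun n => Cmod (u n)) ->
            ex_series (fun n => Cmod (v n)) -> ex_series (fun n => Cmod (u n + v n)%C)).
  { intros u v Hu Hv.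
    apply ex_series_le_R with (fun n => Cmod (u n) + Cmod (v n)).
    - intro n; rewrite Rabs_pos_eq by apply Cmod_ge_0; apply Cmod_triangle.
    - now apply (ex_series_plus (fun n => Cmod (u n))). }
  assert (E : (CPSeries a (z + h) - CPSeries a z - h * CPSeries (PS_derive a) z)%C =
    CSeries (fun n => RtoC (a n) * (z + h) ^ n + (- (1)) * (RtoC (a n) * z ^ n)
                      + (- h) * d n)%C).
  { rewrite CSeries_plus, CSeries_plus, !CSeries_scal, Ed by auto.
    fold (CPSeries a (z + h)%C) (CPSeries a z); ring. }
  assert (Hs : ex_series (fun n => Cmod h ^ 2 * (Rabs (a n) * (4 * (Cmod z + 1)) ^ n))).
  { apply ex_series_scal_R, entire_abs_cv; [exact Ha | lra]. }
  rewrite E, <- Series_scal_l.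
  eapply Rle_trans; [apply Cmod_CSeries_le; auto|].
  apply Series_le; [|exact Hs].
  intro n; split; [apply Cmod_ge_0|].
  replace (RtoC (a n) * (z + h) ^ n + (- (1)) * (RtoC (a n) * z ^ n) + (- h) * d n)%C
    with (RtoC (a n) * ((z + h) ^ n - z ^ n - RtoC (INR n) * h * z ^ pred n))%C
    by (unfold d; rewrite RtoC_mult; ring).
  rewrite Cmod_mult, Cmod_R.
  replace (Cmod h ^ 2 * (Rabs (a n) * (4 * (Cmod z + 1)) ^ n))
    with (Rabs (a n) * (Cmod h ^ 2 * (4 * (Cmod z + 1)) ^ n)) by ring.
  apply Rmult_le_compat_l; [apply Rabs_pos | now apply Cpow_taylor_le].
Qed.

Lemma is_derive_CPSeries (a : nat -> R) (z : C) : entire a ->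
  is_derive (K := C_AbsRing) (V := C_NormedModule) (CPSeries a) z
            (CPSeries (PS_derive a) z).
Proof.
  intro Ha; split; [apply is_linear_scal_l|].
  intros x Hx eps.
  (* Differentiability quantifies over every limit point of the neighbourhood filter of z, which can
     only be z. *)
  apply (is_filter_lim_locally_unique (V := AbsRing_NormedModule C_AbsRing)) in Hx.
  change (z = x) in Hx; subst x.
  set (M := Series (fun n => Rabs (a n) * (4 * (Cmod z + 1)) ^ n)).
  assert (HM : 0 <= M).
  { pose proof (CPSeries_taylor_le a z (RtoC 1) Ha) as H; fold M in H.
    rewrite Cmod_1 in H; specialize (H (Rle_refl 1)).
    rewrite pow1, Rmult_1_l in H.
    eapply Rle_trans; [apply Cmod_ge_0 | exact H]. }
  assert (Hd : 0 < Rmin 1 (eps / (M + 1))).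
  { apply Rmin_glb_lt; [lra|]; apply Rdiv_lt_0_compat; [apply cond_pos | lra]. }
  exists (mkposreal _ Hd); intros y Hy.
  change (Cmod (y - z)%C < Rmin 1 (eps / (M + 1))) in Hy.
  change (Cmod (CPSeries a y - CPSeries a z - (y - z) * CPSeries (PS_derive a) z)%C
          <= eps * Cmod (y - z)%C).
  pose proof (Rmin_l 1 (eps / (M + 1))); pose proof (Rmin_r 1 (eps / (M + 1))).
  set (h := (y - z)%C) in *.
  replace y with (z + h)%C by (unfold h; ring).
  eapply Rle_trans; [apply CPSeries_taylor_le; [exact Ha | lra]|].
  fold M; pose proof (Cmod_ge_0 h).
  assert (Hh : Cmod h * (M + 1) <= eps).
  { apply Rle_trans with (eps / (M + 1) * (M + 1)).
    - apply Rmult_le_compat_r; lra.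
    - right; field; lra. }
  replace (Cmod h ^ 2 * M) with (Cmod h * (Cmod h * M)) by ring.
  rewrite (Rmult_comm eps); apply Rmult_le_compat_l; nra.
Qed.

Lemma C_derive_CPSeries (a : nat -> R) : entire a ->
  C_derive (CPSeries a) = CPSeries (PS_derive a).
Proof.
  intro Ha; apply functional_extensionality; intro z.
  now apply is_C_derive_unique, is_derive_CPSeries.
Qed.

Lemma Cpow_minus_le (z w : C) (n : nat) : Cmod z <= 1 -> Cmod w <= 1 ->
  Cmod (z ^ n - w ^ n)%C <= INR n * Cmod (z - w)%C.
Proof.
  intros Hz Hw; induction n as [|n IH].
  - replace (z ^ 0 - w ^ 0)%C with (RtoC 0) by (simpl; ring).
    rewrite Cmod_0; simpl; lra.
  - replace (z ^ S n - w ^ S n)%C with (z * (z ^ n - w ^ n) + (z - w) * w ^ n)%C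
      by (rewrite !Cpow_S; ring).
    eapply Rle_trans; [apply Cmod_triangle|].
    rewrite !Cmod_mult, Cmod_pow, S_INR.
    assert (Hwn : 0 <= Cmod w ^ n <= 1).
    { split; [apply pow_le, Cmod_ge_0|].
      rewrite <- (pow1 n); apply pow_incr; split; [apply Cmod_ge_0 | exact Hw]. }
    pose proof (Cmod_ge_0 (z ^ n - w ^ n)%C); pose proof (Cmod_ge_0 (z - w)%C).
    pose proof (Cmod_ge_0 z).
    nra.
Qed.

(** * The functions psi and phi, and the convexity quotient *)

Lemma psi_coef_neq_0 (m : R) (n : nat) : 0 < m -> psi_coef m n <> 0.
Proof.
  intro Hm; induction n as [|n IH]; cbn [psi_coef]; [lra|].
  pose proof (INR_S_ge_1 n); pose proof (pos_INR n).
  apply Rmult_integral_contrapositive_currified; [lra|].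
  apply Rinv_neq_0_compat; nra.
Qed.

Lemma psi_coef_entire (m : R) : 0 < m -> entire (psi_coef m).
Proof.
  intro Hm; apply CV_radius_infinite_DAlembert.
  - intro n; now apply psi_coef_neq_0.
  - apply is_lim_seq_le_le with (u := fun _ => 0) (w := fun n => / m * / INR (S n)).
    + intro n; pose proof (psi_coef_neq_0 m n Hm) as Hc.
      pose proof (INR_S_ge_1 n); pose proof (pos_INR n).
      split; [apply Rabs_pos|].
      cbn [psi_coef].
      replace (- psi_coef m n / (4 * INR (S n) * (m + INR n)) / psi_coef m n)
        with (- / (4 * INR (S n) * (m + INR n))) by (field; repeat split; lra).
      rewrite Rabs_Ropp, Rabs_pos_eq by (left; apply Rinv_0_lt_compat; nra).
      rewrite <- Rinv_mult; apply Rinv_le_contravar; nra.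
    + apply is_lim_seq_const.
    + replace (Finite 0) with (Finite (/ m * 0)) by (f_equal; ring).
      apply (is_lim_seq_scal_l _ (/ m) 0).
      apply (is_lim_seq_incr_1 (fun n => / INR n)).
      replace (Finite 0) with (Rbar_inv p_infty) by reflexivity.
      apply is_lim_seq_inv; [apply is_lim_seq_INR | discriminate].
Qed.

Lemma phi_coef_entire (m : R) : 0 < m -> m <> 1 -> entire (phi_coef (m - 2)).
Proof.
  intros Hm Hm1; unfold entire.
  rewrite <- CV_radius_derive, (functional_extensionality _ (PS_scal (- / (4 * (m - 1))) (psi_coef m))).
  - rewrite CV_radius_scal; [now apply psi_coef_entire|].
    apply Ropp_neq_0_compat, Rinv_neq_0_compat; lra.
  - intro n; now apply PS_derive_phi_coef.
Qed.

Lemma Cmult_CPSeries_derive (a : nat -> R) (z : C) : entire a ->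
  (z * CPSeries (PS_derive a) z)%C = CPSeries (fun n => INR n * a n) z.
Proof.
  intro Ha.
  assert (Hd := ex_series_CPS (PS_derive a) z
                  (entire_abs_cv _ _ (entire_derive a Ha) (Cmod_ge_0 z))).
  assert (E : forall n, (z * (RtoC (PS_derive a n) * z ^ n) =
                         RtoC (INR (S n) * a (S n)) * z ^ S n)%C)
    by (intro n; rewrite Cpow_S; unfold PS_derive; ring).
  unfold CPSeries; rewrite <- CSeries_scal by exact Hd.
  rewrite (CSeries_incr_1 (fun n => RtoC (INR n * a n) * z ^ n)%C).
  - simpl INR; rewrite Rmult_0_l, Cmult_0_l, Cplus_0_l.
    now apply CSeries_ext.
  - apply (ex_series_incr_1 (fun n => Cmod (RtoC (INR n * a n) * z ^ n)%C)).
    apply ex_series_ext_R with (fun n => Cmod z * Cmod (RtoC (PS_derive a n) * z ^ n)%C).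
    + intro n; rewrite <- E; symmetry; apply Cmod_mult.
    + now apply ex_series_scal_R.
Qed.

Definition psi (m : R) (z : C) : C := CPSeries (psi_coef m) z.

(** The function z psi'(z). *)
Definition psi_euler (m : R) (z : C) : C :=
  CPSeries (fun n => INR n * psi_coef m n) z.

Lemma C_derive_phi (m : R) (z : C) : 0 < m -> m <> 1 ->
  C_derive (phi (m - 2)) z = (RtoC (- / (4 * (m - 1))) * psi m z)%C.
Proof.
  intros Hm Hm1.
  change (phi (m - 2)) with (CPSeries (phi_coef (m - 2))).
  rewrite C_derive_CPSeries by now apply phi_coef_entire.
  unfold psi; rewrite <- CPSeries_scal
    by (apply entire_abs_cv; [now apply psi_coef_entire | apply Cmod_ge_0]).
  apply CPSeries_ext; intro n; now apply PS_derive_phi_coef.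
Qed.

Lemma C_derive2_phi (m : R) (z : C) : 0 < m -> m <> 1 ->
  (z * C_derive (C_derive (phi (m - 2))) z)%C
  = (RtoC (- / (4 * (m - 1))) * psi_euler m z)%C.
Proof.
  intros Hm Hm1.
  change (phi (m - 2)) with (CPSeries (phi_coef (m - 2))).
  pose proof (phi_coef_entire m Hm Hm1) as He.
  pose proof (psi_coef_entire m Hm) as Hp.
  rewrite (C_derive_CPSeries _ He), C_derive_CPSeries by now apply entire_derive.
  unfold psi_euler; rewrite <- Cmult_CPSeries_derive by exact Hp.
  rewrite (CPSeries_ext (PS_derive (PS_derive (phi_coef (m - 2))))
             (fun n => - / (4 * (m - 1)) * PS_derive (psi_coef m) n)).
  - rewrite CPSeries_scal; [ring|].
    apply entire_abs_cv; [now apply entire_derive | apply Cmod_ge_0].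
  - intro n; unfold PS_derive at 1; rewrite PS_derive_phi_coef by assumption.
    unfold PS_derive; ring.
Qed.

Lemma phi_convexity_quotient (m : R) (z : C) : 0 < m -> m <> 1 ->
  psi m z <> RtoC 0 ->
  (RtoC 1 + z * C_derive (C_derive (phi (m - 2))) z / C_derive (phi (m - 2)) z)%C
  = (RtoC 1 + psi_euler m z / psi m z)%C.
Proof.
  intros Hm Hm1 Hpsi.
  rewrite C_derive2_phi, C_derive_phi by assumption.
  assert (HC : RtoC (- / (4 * (m - 1))) <> RtoC 0).
  { intro H; apply RtoC_inj in H; revert H.
    apply Ropp_neq_0_compat, Rinv_neq_0_compat; lra. }
  field; now split.
Qed.

Lemma rayleigh_abs_cv (m r : R) : / 4 < m -> 0 <= r <= 1 ->
  CPS_abs_cv (rayleigh m) r.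
Proof.
  intros Hm Hr.
  apply ex_series_le_R with (2 := ex_series_rayleigh m Hm); intro n.
  assert (0 <= r ^ n <= 1)
    by (split; [now apply pow_le | rewrite <- (pow1 n); now apply pow_incr]).
  pose proof (Rabs_pos (rayleigh m n)).
  rewrite Rabs_pos_eq; nra.
Qed.

Lemma rayleigh_psi (m : R) (z : C) : / 4 < m -> Cmod z <= 1 ->
  psi_euler m z = (- (CPSeries (rayleigh m) z * psi m z))%C.
Proof.
  intros Hm Hz; pose proof (Cmod_ge_0 z) as Hz0.
  assert (Hp : entire (psi_coef m)) by (apply psi_coef_entire; lra).
  unfold psi; rewrite CPSeries_mult;
    [|now apply rayleigh_abs_cv | now apply entire_abs_cv].
  rewrite (CPSeries_ext _ (fun n => -1 * (INR n * psi_coef m n)))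
    by (intro n; rewrite rayleigh_newton by lra; ring).
  rewrite CPSeries_scal.
  - fold (psi_euler m z); change (RtoC (-1)) with (RtoC (- (1))); rewrite RtoC_opp; ring.
  - apply (ex_series_incr_1 (fun n => Rabs (INR n * psi_coef m n) * Cmod z ^ n)).
    apply ex_series_ext_R with (fun n => Cmod z * (Rabs (PS_derive (psi_coef m) n) * Cmod z ^ n)).
    + intro n; unfold PS_derive; simpl pow; ring.
    + apply ex_series_scal_R, (entire_abs_cv (PS_derive (psi_coef m)));
        [now apply entire_derive | exact Hz0].
Qed.

Lemma phi_convexity_rayleigh (m : R) (z : C) : / 4 < m -> m <> 1 -> Cmod z <= 1 ->
  psi m z <> RtoC 0 ->
  (RtoC 1 + z * C_derive (C_derive (phi (m - 2))) z / C_derive (phi (m - 2)) z)%C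
  = (RtoC 1 - CPSeries (rayleigh m) z)%C.
Proof.
  intros Hm Hm1 Hz Hpsi.
  rewrite phi_convexity_quotient, rayleigh_psi by (lra || assumption).
  field; exact Hpsi.
Qed.

Lemma Cmod_rayleigh_lt (m : R) (z : C) : / 4 < m -> Cmod z < 1 ->
  Cmod (CPSeries (rayleigh m) z) < rayleigh_sum m.
Proof.
  intros Hm Hz; pose proof (Cmod_ge_0 z) as Hz0.
  pose proof (rayleigh_sum_pos m Hm) as HS.
  apply Rle_lt_trans with (Cmod z * rayleigh_sum m); [|nra].
  pose proof (ex_series_Rabs _ (ex_series_rayleigh m Hm)) as Hex.
  unfold rayleigh_sum; rewrite <- Series_scal_l.
  eapply Rle_trans; [apply Cmod_CSeries_le|].
  - apply ex_series_CPS, rayleigh_abs_cv; lra.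
  - apply Series_le; [|now apply ex_series_scal_R].
    intro n; split; [apply Cmod_ge_0|].
    rewrite Cmod_CPS_term.
    pose proof (rayleigh_bounds m n ltac:(lra)).
    rewrite Rabs_pos_eq by lra.
    destruct n as [|n]; [rewrite rayleigh_0; lra|].
    assert (0 <= Cmod z ^ n <= 1)
      by (split; [now apply pow_le | rewrite <- (pow1 n); apply pow_incr; lra]).
    simpl pow.
    rewrite (Rmult_comm (rayleigh _ _)); apply Rmult_le_compat_r; nra.
Qed.

(** * Nonvanishing of psi and univalence of phi *)

Lemma psi_coef_tail (m : R) : 0 < m ->
  ex_series (fun n => Rabs (psi_coef m (S n))) /\
  Series (fun n => Rabs (psi_coef m (S n))) <= / (3 * m).
Proof.
  intro Hm.
  assert (Hb : forall n, 0 <= Rabs (psi_coef m (S n)) <= / (4 * m) * (/ 4) ^ n).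
  { intro n; split; [apply Rabs_pos|].
    pose proof (tau_le m n Hm) as H; unfold tau in H.
    rewrite Rabs_mult, (Rabs_pos_eq m), inv_4_pow in H by lra.
    apply Rmult_le_reg_l with m; [exact Hm|].
    simpl pow in H.
    replace (m * (/ (4 * m) * (/ 4) ^ n)) with (/ 4 * (/ 4) ^ n) by (field; lra).
    exact H. }
  assert (Hg : is_series (fun n => / (4 * m) * (/ 4) ^ n) (/ (4 * m) * / (1 - / 4))).
  { apply (is_series_scal_l (/ (4 * m)) _ (/ (1 - / 4))), is_series_geom.
    rewrite Rabs_pos_eq; lra. }
  split.
  - apply ex_series_le_R with (fun n => / (4 * m) * (/ 4) ^ n); [|eexists; exact Hg].
    intro n; rewrite Rabs_Rabsolu; apply Hb.
  - replace (/ (3 * m)) with (/ (4 * m) * / (1 - / 4)) by (field; lra).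
    rewrite <- (is_series_unique _ _ Hg).
    apply Series_le; [exact Hb | eexists; exact Hg].
Qed.

(** On the closed disk |psi - 1| <= 1 / (3 m), and m > 1/3 makes this less than 1. *)
Lemma psi_neq_0 (m : R) (z : C) : / 3 < m -> Cmod z <= 1 -> psi m z <> RtoC 0.
Proof.
  intros Hm Hz E; pose proof (Cmod_ge_0 z) as Hz0.
  destruct (psi_coef_tail m) as [Hex Hle]; [lra|].
  assert (He : ex_series (fun n => Cmod (RtoC (psi_coef m n) * z ^ n)%C)).
  { apply ex_series_CPS, entire_abs_cv; [apply psi_coef_entire; lra | exact Hz0]. }
  unfold psi, CPSeries in E; rewrite CSeries_incr_1 in E by exact He.
  assert (He1 := proj1 (ex_series_incr_1 _) He).
  pose proof (Cmod_CSeries_le _ He1) as H1.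
  set (s := CSeries (fun n => RtoC (psi_coef m (S n)) * z ^ S n)%C) in *.
  assert (Hs : s = (- (1))%C).
  { apply (f_equal (fun x => x - RtoC (psi_coef m 0) * z ^ 0)%C) in E.
    cbn [psi_coef Cpow] in E.
    transitivity (1 * 1 + s - 1 * 1)%C; [ring|]; rewrite E; ring. }
  rewrite Hs, Cmod_m1 in H1.
  assert (H2 : Series (fun n => Cmod (RtoC (psi_coef m (S n)) * z ^ S n)%C)
               <= Series (fun n => Rabs (psi_coef m (S n)))).
  { apply Series_le; [|exact Hex].
    intro n; split; [apply Cmod_ge_0|].
    rewrite Cmod_mult, Cmod_R, Cmod_pow.
    assert (0 <= Cmod z ^ S n <= 1)
      by (split; [now apply pow_le | rewrite <- (pow1 (S n)); apply pow_incr; lra]).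
    pose proof (Rabs_pos (psi_coef m (S n))); nra. }
  assert (/ (3 * m) < 1) by (rewrite <- Rinv_1; apply Rinv_lt_contravar; lra).
  lra.
Qed.

(** With c = phi'(0), the difference phi(z) - phi(w) is c (z - w) plus terms of degree at least 2.
    Since |z^n - w^n| <= n |z - w| on the closed disk, those terms total at most |c| |z - w| / (3
    m), too little to cancel the linear term unless z = w. *)
Lemma phi_injective (m : R) (z w : C) : / 3 < m -> m <> 1 ->
  Cmod z <= 1 -> Cmod w <= 1 -> phi (m - 2) z = phi (m - 2) w -> z = w.
Proof.
  intros Hm Hm1 Hz Hw E.
  pose proof (phi_coef_entire m ltac:(lra) Hm1) as He.
  set (d := phi_coef (m - 2)) in *; set (c := - / (4 * (m - 1))).
  set (u := fun n => (RtoC (d n) * (z ^ n - w ^ n))%C).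
  assert (Hez := ex_series_CPS d z (entire_abs_cv d _ He (Cmod_ge_0 z))).
  assert (Hew := ex_series_CPS d w (entire_abs_cv d _ He (Cmod_ge_0 w))).
  assert (Hew' : ex_series (fun n => Cmod (- (1) * (RtoC (d n) * w ^ n))%C)).
  { revert Hew; apply ex_series_ext_R; intro n.
    now rewrite (Cmod_mult (- (1))), Cmod_m1, Rmult_1_l. }
  assert (Eu : forall n, u n = (RtoC (d n) * z ^ n + - (1) * (RtoC (d n) * w ^ n))%C)
    by (intro n; unfold u; ring).
  assert (Hu : ex_series (fun n => Cmod (u n))).
  { apply ex_series_le_R with
      (fun n => Cmod (RtoC (d n) * z ^ n)%C + Cmod (- (1) * (RtoC (d n) * w ^ n))%C).
    - intro n; rewrite Rabs_pos_eq, Eu by apply Cmod_ge_0; apply Cmod_triangle.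
    - now apply (ex_series_plus (fun n => Cmod (RtoC (d n) * z ^ n)%C)). }
  assert (E0 : CSeries u = RtoC 0).
  { rewrite (CSeries_ext _ _ Eu), CSeries_plus, CSeries_scal by assumption.
    change (phi (m - 2) z + - (1) * phi (m - 2) w = 0)%C; rewrite E; ring. }
  assert (Hu1 := proj1 (ex_series_incr_1 _) Hu).
  assert (Hu2 := proj1 (ex_series_incr_1 _) Hu1).
  rewrite CSeries_incr_1, (CSeries_incr_1 (fun n => u (S n))) in E0 by assumption.
  pose proof (Cmod_CSeries_le _ Hu2) as Hs.
  set (s := CSeries (fun n => u (S (S n)))) in *.
  assert (Es : s = (- (RtoC c * (z - w)))%C).
  { apply (f_equal (fun x => x - (u 0%nat + u 1%nat))%C) in E0.
    replace s with (u 0%nat + (u 1%nat + s) - (u 0%nat + u 1%nat))%C by ring.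
    rewrite E0; unfold u, d; rewrite phi_coef_1 by lra; fold c.
    cbn [Cpow]; ring. }
  rewrite Es, Cmod_opp, Cmod_mult, Cmod_R in Hs.
  destruct (psi_coef_tail m) as [Hex Hle]; [lra|].
  set (D := Cmod (z - w)%C) in *.
  assert (H2 : Series (fun n => Cmod (u (S (S n))))
               <= Series (fun n => Rabs c * D * Rabs (psi_coef m (S n)))).
  { apply Series_le; [|now apply ex_series_scal_R].
    intro n; split; [apply Cmod_ge_0|].
    unfold u; rewrite Cmod_mult, Cmod_R.
    pose proof (PS_derive_phi_coef m (S n) ltac:(lra) Hm1) as Hd.
    fold d c in Hd; unfold PS_derive in Hd.
    replace (Rabs c * D * Rabs (psi_coef m (S n)))
      with (D * Rabs (c * psi_coef m (S n))) by (rewrite Rabs_mult; ring).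
    rewrite <- Hd, Rabs_mult, (Rabs_pos_eq (INR _)) by apply pos_INR.
    replace (D * (INR (S (S n)) * Rabs (d (S (S n)))))
      with (Rabs (d (S (S n))) * (INR (S (S n)) * D)) by ring.
    apply Rmult_le_compat_l; [apply Rabs_pos | now apply Cpow_minus_le]. }
  rewrite Series_scal_l in H2.
  assert (Hlt : / (3 * m) < 1) by (rewrite <- Rinv_1; apply Rinv_lt_contravar; lra).
  assert (Hc : 0 < Rabs c).
  { apply Rabs_pos_lt, Ropp_neq_0_compat, Rinv_neq_0_compat; lra. }
  assert (HD : 0 <= D) by apply Cmod_ge_0.
  assert (HD0 : D = 0).
  { set (S1 := Series (fun n => Rabs (psi_coef m (S n)))) in *.
    destruct HD as [HD|HD]; [exfalso|easy].
    assert (0 < Rabs c * D) by nra.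
    nra. }
  apply Cmod_eq_0 in HD0.
  replace z with (z - w + w)%C by ring; rewrite HD0; ring.
Qed.

(** * Convexity of order alpha against the size of h(1) *)

Lemma convex_of_order_phi (alpha m : R) : / 3 < m -> m <> 1 ->
  rayleigh_sum m <= 1 - alpha -> convex_of_order alpha (phi (m - 2)).
Proof.
  intros Hm Hm1 HS; split; [|split].
  - intros z _; eexists.
    apply (is_derive_CPSeries (phi_coef (m - 2))), phi_coef_entire; lra.
  - intros z w Hz Hw; apply phi_injective; lra.
  - intros z Hz.
    pose proof (psi_neq_0 m z Hm ltac:(lra)) as Hpsi.
    split.
    + rewrite C_derive_phi by lra.
      apply Cmult_neq_0; [|exact Hpsi].
      intro H; apply RtoC_inj in H; revert H.
      apply Ropp_neq_0_compat, Rinv_neq_0_compat; lra.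
    + rewrite phi_convexity_rayleigh by (lra || assumption).
      pose proof (Cmod_rayleigh_lt m z ltac:(lra) Hz) as H.
      pose proof (re_le_Cmod (CPSeries (rayleigh m) z)) as Hre.
      apply Rabs_le_between in Hre.
      change (1 - Re (CPSeries (rayleigh m) z) > alpha); lra.
Qed.

Lemma C_derive_phi_neq_0 (m : R) (z : C) : 0 < m -> m <> 1 ->
  C_derive (phi (m - 2)) z <> RtoC 0 -> psi m z <> RtoC 0.
Proof.
  intros Hm Hm1 H E; apply H; rewrite C_derive_phi, E by assumption; ring.
Qed.

(** The coefficient bound gives a radius of convergence of at least 4 m > 1, so 1 is an interior
    point. *)
Lemma PSeries_rayleigh_continuous (m : R) : / 4 < m ->
  continuity_pt (PSeries (rayleigh m)) 1.
Proof.
  intro Hm; apply PSeries_continuity; rewrite Rabs_R1.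
  apply Rbar_lt_le_trans with (4 * m); [simpl; lra|].
  apply (proj1 (CV_radius_bounded (rayleigh m))).
  exists 1; intro n.
  pose proof (rayleigh_bounds m n ltac:(lra)) as H.
  rewrite pow_inv in H.
  assert (Hp : 0 < (4 * m) ^ n) by (apply pow_lt; lra).
  rewrite Rabs_pos_eq by nra.
  apply Rle_trans with (/ (4 * m) ^ n * (4 * m) ^ n).
  - apply Rmult_le_compat_r; lra.
  - right; field; lra.
Qed.

(** At real x in the disk the condition reads 1 - h(x) > alpha; letting x tend to 1 leaves the weak
    inequality. *)
Lemma convex_of_order_rayleigh_le (alpha m : R) : / 4 < m -> m <> 1 ->
  convex_of_order alpha (phi (m - 2)) -> rayleigh_sum m <= 1 - alpha.
Proof.
  intros Hm Hm1 (_ & _ & H).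
  destruct (Rle_dec (rayleigh_sum m) (1 - alpha)) as [Hle|Hgt]; [exact Hle|exfalso].
  destruct (PSeries_rayleigh_continuous m Hm (rayleigh_sum m - (1 - alpha)))
    as (delta & Hdelta & Hcont); [lra|].
  set (x := Rmax (/ 2) (1 - delta / 2)).
  assert (Hx : / 2 <= x < 1) by (split; [apply Rmax_l | apply Rmax_lub_lt; lra]).
  assert (Hx' : 1 - delta / 2 <= x) by apply Rmax_r.
  assert (Hmod : Cmod (RtoC x) < 1) by (rewrite Cmod_R, Rabs_pos_eq; lra).
  destruct (H (RtoC x) Hmod) as [Hd Hre].
  rewrite phi_convexity_rayleigh, CPSeries_real in Hre;
    [|exact Hm|exact Hm1|lra|apply C_derive_phi_neq_0; [lra|exact Hm1|exact Hd]].
  change (1 - PSeries (rayleigh m) x > alpha) in Hre.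
  specialize (Hcont x); simpl in Hcont; unfold Rdist in Hcont.
  rewrite PSeries_1 in Hcont; fold (rayleigh_sum m) in Hcont.
  assert (Hclose : Rabs (PSeries (rayleigh m) x - rayleigh_sum m)
                   < rayleigh_sum m - (1 - alpha)).
  { apply Hcont; split; [split; [exact I | lra]|].
    rewrite Rabs_left; lra. }
  apply Rabs_def2 in Hclose; lra.
Qed.

(* At [x = 16 m / 5 < 1] one has [psi x > 0] but [psi x + x * psi' x < 0]. *)
Lemma not_convex_of_order_small (alpha m : R) : 0 < m <= / 4 -> 0 <= alpha ->
  ~ convex_of_order alpha (phi (m - 2)).
Proof.
  intros Hm Halpha (_ & _ & H).
  (* This choice makes the linear term of psi equal to - 4/5 for every m, and m <= 1/4 keeps x <=
     4/5. *)
  set (x := 16 / 5 * m).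
  assert (Hmod : Cmod (RtoC x) < 1)
    by (rewrite Cmod_R, Rabs_pos_eq; unfold x; lra).
  destruct (H (RtoC x) Hmod) as [Hd Hre].
  apply C_derive_phi_neq_0 in Hd; [|lra..].
  rewrite phi_convexity_quotient in Hre by (lra || assumption).
  unfold psi, psi_euler in *; rewrite !CPSeries_real in *.
  set (e := fun n => psi_coef m n * x ^ n).
  (* The constant is 4/5 times 1/5, because m / (m + n) <= 1/5 for m <= 1/4 and n >= 1. The tails
     are then at most 16/105 around 1/5 for psi, and 32/105 around - 3/5 for psi + x psi'. *)
  assert (Hratio : forall n, (1 <= n)%nat ->
            INR (S n) * Rabs (e (S n)) <= 4 / 25 * Rabs (e n)).
  { intros n Hn; pose proof (INR_S_ge_1 n) as HS; apply le_INR in Hn; simpl in Hn.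
    replace (e (S n)) with (- (4 / 5 * m / (INR (S n) * (m + INR n))) * e n).
    2: { unfold e, x; cbn [psi_coef]; simpl pow; field; lra. }
    rewrite Rabs_mult, Rabs_Ropp, (Rabs_pos_eq (_ / _))
      by (apply Rlt_le, Rdiv_lt_0_compat; nra).
    rewrite <- Rmult_assoc; apply Rmult_le_compat_r; [apply Rabs_pos|].
    replace (INR (S n) * (4 / 5 * m / (INR (S n) * (m + INR n))))
      with (4 / 5 * m / (m + INR n)) by (field; lra).
    apply Rdiv_le_l; lra. }
  assert (He0 : e 0%nat = 1) by (unfold e; simpl; ring).
  assert (He1 : e 1%nat = - (4 / 5)) by (unfold e, x; simpl; field; lra).
  destruct (Series_ratio_tail_le e 1 (4 / 25)) as [Hex Htail]; [lra| |].
  { intros n Hn; pose proof (Hratio n Hn); pose proof (INR_S_ge_1 n).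
    pose proof (Rabs_pos (e (S n))); nra. }
  destruct (Series_ratio_tail_le (fun n => e n + INR n * e n) 1 (4 / 25))
    as [Hex' Htail']; [lra| |].
  { intros n Hn; pose proof (Hratio n Hn) as Hr; apply le_INR in Hn; simpl in Hn.
    replace (e (S n) + INR (S n) * e (S n)) with ((1 + INR (S n)) * e (S n)) by ring.
    replace (e n + INR n * e n) with ((1 + INR n) * e n) by ring.
    rewrite !Rabs_mult, !(Rabs_pos_eq (1 + _)) by (pose proof (pos_INR (S n)); lra).
    rewrite S_INR in *.
    pose proof (Rabs_pos (e (S n))); pose proof (Rabs_pos (e n)); nra. }
  assert (Esum : Series (fun n => e n + INR n * e n)
                 = PSeries (psi_coef m) x + PSeries (fun n => INR n * psi_coef m n) x).
  { rewrite Series_plus.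
    - f_equal; apply Series_ext; intro n; unfold e; ring.
    - now apply ex_series_Rabs.
    - apply ex_series_ext_R with (fun n => (e n + INR n * e n) + -1 * e n); [intro; ring|].
      apply (ex_series_plus (fun n => e n + INR n * e n) (fun n => -1 * e n)).
      + now apply ex_series_Rabs.
      + apply ex_series_scal_R; now apply ex_series_Rabs. }
  rewrite Esum in Htail'; change (Series e) with (PSeries (psi_coef m) x) in Htail.
  cbn [sum_f_R0] in Htail, Htail'; simpl INR in Htail'.
  rewrite He0, He1 in Htail, Htail'.
  rewrite (Rabs_left (- (4 / 5))) in Htail by lra.
  rewrite (Rabs_left (_ + _ * _)) in Htail' by lra.
  apply Rabs_le_between in Htail; apply Rabs_le_between in Htail'.
  set (A := PSeries (psi_coef m) x) in *.
  set (B := PSeries (fun n => INR n * psi_coef m n) x) in *.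
  assert (HA : 0 < A) by lra.
  rewrite <- RtoC_div, <- RtoC_plus in Hre by lra.
  change (1 + B / A > alpha) in Hre.
  assert (HBA : B / A * A = B) by (field; lra).
  nra.
Qed.

(** * The threshold in m and its identification with the Bessel equation *)

Lemma convex_of_order_phi_iff (alpha ma m : R) : 0 <= alpha -> / 3 < ma ->
  rayleigh_sum ma = 1 - alpha -> 0 < m -> m <> 1 ->
  (convex_of_order alpha (phi (m - 2)) <-> ma <= m).
Proof.
  intros Halpha Hma HS Hm Hm1; split; intro H.
  - destruct (Rle_dec m (/ 4)) as [Hle|Hgt].
    + exfalso; apply (not_convex_of_order_small alpha m); [lra | lra | exact H].
    + destruct (Rle_dec ma m) as [|Hlt]; [assumption|exfalso].
      apply convex_of_order_rayleigh_le in H; [|lra|exact Hm1].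
      pose proof (rayleigh_sum_decr m ma ltac:(lra) ltac:(lra)); lra.
  - apply convex_of_order_phi; [lra | exact Hm1|].
    destruct H as [H|<-]; [|lra].
    pose proof (rayleigh_sum_decr ma m ltac:(lra) H); lra.
Qed.

(** To the right of the root of T, T is positive, so a root of W means b = U / T. If m were at most
    1/4, then b T <= T <= m - 1/6 <= 1/12, while U >= 1/6; hence every such root lies where h(1)
    converges and equals U / T. *)
Lemma W_root_rayleigh (ms b m : R) : 0 < ms -> T ms = 0 -> 0 < b <= 1 -> ms < m ->
  W b m = 0 -> / 4 < m /\ rayleigh_sum m = b.
Proof.
  intros Hms HT Hb Hm HW.
  pose proof (T_increasing ms m Hms Hm) as HTm; rewrite HT in HTm.
  pose proof (U_bounds m ltac:(lra)).
  rewrite W_T_U in HW by lra.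
  assert (Hm4 : / 4 < m).
  { destruct (Rlt_dec (/ 4) m) as [|Hle]; [assumption|exfalso].
    pose proof (T_bounds m ltac:(lra)); nra. }
  split; [exact Hm4|].
  pose proof (rayleigh_sum_T m Hm4).
  apply Rmult_eq_reg_r with (T m); lra.
Qed.

Lemma convexity_threshold (ms alpha lo hi : R) : 0 < ms < lo -> T ms = 0 ->
  0 <= alpha < 1 -> / 3 < lo < hi ->
  W (1 - alpha) lo < 0 -> 0 < W (1 - alpha) hi ->
  exists nu_a : R,
    unique (fun nu => ms - 2 < nu /\
              (2 * nu + 2 * alpha) * BesselJ (nu + 1) 1 = BesselJ nu 1) nu_a /\
    lo - 2 < nu_a < hi - 2 /\
    (forall nu, -2 < nu -> nu <> -1 ->
       (convex_of_order alpha (phi nu) <-> nu >= nu_a)).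
Proof.
  intros Hms HT Halpha Hlo Hneg Hpos.
  destruct (W_root (1 - alpha) lo hi) as (ma & Hma & EW); [lra|lra|assumption..|].
  destruct (W_root_rayleigh ms (1 - alpha) ma) as [_ HS]; [lra|exact HT|lra|lra|exact EW|].
  exists (ma - 2); split; [|split].
  - split.
    + split; [lra|].
      replace (ma - 2 + 1) with (ma - 1) by ring.
      apply BesselJ_equation_iff; [lra | exact EW].
    + intros nu [Hnu E].
      set (m := nu + 2).
      replace nu with (m - 2) in E |- * by (unfold m; ring).
      replace (m - 2 + 1) with (m - 1) in E by ring.
      apply BesselJ_equation_iff in E; [|unfold m; lra].
      destruct (W_root_rayleigh ms (1 - alpha) m) as [Hm4 HSm];
        [lra|exact HT|lra|unfold m; lra|exact E|].
      f_equal.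
      destruct (Rtotal_order ma m) as [Hlt|[Heq|Hgt]]; [exfalso|exact Heq|exfalso].
      * pose proof (rayleigh_sum_decr ma m ltac:(lra) Hlt); lra.
      * pose proof (rayleigh_sum_decr m ma ltac:(lra) Hgt); lra.
  - lra.
  - intros nu Hnu Hnu1.
    pose proof (convex_of_order_phi_iff alpha ma (nu + 2)) as Hiff.
    replace (nu + 2 - 2) with nu in Hiff by ring.
    rewrite Hiff by lra; split; intro; lra.
Qed.

Theorem theorem8 :
  exists nustar : R,
    unique (fun nu : R => -2 < nu /\ BesselJ (nu + 1) 1 = 0) nustar /\
    -1.775 < nustar < -1.774 /\
    (forall alpha : R, 0 <= alpha < 1 ->
       exists nu_alpha : R,
         unique (fun nu : R =>
                   nustar < nu /\
                   (2 * nu + 2 * alpha) * BesselJ (nu + 1) 1 = BesselJ nu 1)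
                nu_alpha /\
         (forall nu : R, -2 < nu -> nu <> -1 ->
            (convex_of_order alpha (phi nu) <-> nu >= nu_alpha))) /\
    (exists nu_0 : R,
       unique (fun nu : R =>
                 nustar < nu /\ BesselJ nu 1 = 2 * nu * BesselJ (nu + 1) 1)
              nu_0 /\
       -1.5624 < nu_0 < -1.5623 /\
       (forall nu : R, -2 < nu -> nu <> -1 ->
          (convex (phi nu) <-> nu >= nu_0))).
Proof.
  destruct T_root as (ms & Hms & HT).
  exists (ms - 2); split; [|split; [lra|split]].
  - split.
    + split; [lra|].
      replace (ms - 2 + 1) with (ms - 1) by ring.
      apply BesselJ_root_iff; [lra | exact HT].
    + intros nu [Hnu E].
      replace (nu + 1) with (nu + 2 - 1) in E by ring.
      apply BesselJ_root_iff in E; [|lra].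
      destruct (Rtotal_order ms (nu + 2)) as [Hlt|[Heq|Hgt]]; [exfalso|lra|exfalso].
      * pose proof (T_increasing ms (nu + 2) ltac:(lra) Hlt); lra.
      * pose proof (T_increasing (nu + 2) ms ltac:(lra) Hgt); lra.
  - intros alpha Halpha.
    assert (Hinv : 1 <= / (1 - alpha)) by (rewrite <- Rinv_1; apply Rinv_le_contravar; lra).
    (* The upper end is chosen so that (1 - alpha) T exceeds 1 there, by T >= m - 1/3, while U <=
       1/3. *)
    destruct (convexity_threshold ms alpha (547 / 1250) (/ (1 - alpha) + 1))
      as (nu_a & Huniq & _ & Hiff); [lra|exact HT|exact Halpha|lra| | |].
    (* Here T > 0, as the point lies beyond the root of T, so lowering the weight from 1 to 1 -
       alpha only decreases W. *)
    + pose proof W1_neg as HW; rewrite W_T_U in HW |- * by lra.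
      pose proof (T_increasing ms (547 / 1250) ltac:(lra) ltac:(lra)) as HTi; nra.
    + rewrite W_T_U by lra.
      pose proof (T_bounds (/ (1 - alpha) + 1) ltac:(lra)).
      pose proof (U_bounds (/ (1 - alpha) + 1) ltac:(lra)).
      assert ((1 - alpha) * / (1 - alpha) = 1) by (field; lra).
      nra.
    + exists nu_a; split; assumption.
  - destruct (convexity_threshold ms 0 (547 / 1250) (4377 / 10000))
      as (nu_0 & [[Hnu0 E0] Huniq] & Hbounds & Hiff);
      [lra|exact HT|lra|lra|rewrite Rminus_0_r; apply W1_neg
      |rewrite Rminus_0_r; apply W1_pos|].
    exists nu_0; split; [|split; [lra|exact Hiff]].
    split.
    + split; [exact Hnu0 | rewrite <- E0; ring].
    + intros nu [Hnu E]; apply Huniq; split; [exact Hnu | rewrite E; ring].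
Qed.
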